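(* Let $\mathcal J\ge1$ be an integer and let $B=B(b_1,\dots,b_n)$ be a $\mathcal J$-attacking board. Then, as an identity in $z$, $$\prod_{i=1}^n[z+b_i-\mathcal J(i-1)]_{aq^{2(\mathcal J(i-1)-b_i)},\,bq^{\mathcal J(i-1)-b_i};q,p}=\sum_{k=0}^n r^{\mathcal J}_{n-k}(a,b;q,p;B)\prod_{j=1}^k[z-\mathcal J(j-1)]_{aq^{2\mathcal J(j-1)},\,bq^{\mathcal J(j-1)};q,p}.$$
   Context: Theta functions: for $x\neq 0$ and $|p|<1$, $\theta(x;p)=\prod_{j\ge0}(1-p^jx)(1-p^{j+1}/x)$, $\theta(x_1,\dots,x_m;p)=\prod_l\theta(x_l;p)$. For nonzero complex $a,b,q$ (generic) define $w_{a,b;q,p}(k)=\frac{\theta(aq^{2k+1},bq^{k},aq^{k-2}/b;p)}{\theta(aq^{2k-1},bq^{k+2},aq^{k}/b;p)}\,q$ and $[z]_{a,b;q,p}=\frac{\theta(q^z,aq^z,bq^2,a/b;p)}{\theta(q,aq,bq^{z+1},aq^{z-1}/b;p)}$; subscripts like $[x]_{aq^{2s},bq^s;q,p}$ mean $(a,b)$ replaced by $(aq^{2s},bq^s)$. Cells $(i,j)$: column $i$, row $j$; $B(b_1,\dots,b_n)=\{(i,j):1\le i\le n,1\le j\le b_i\}$. A Ferrers board $B(b_1,\dots,b_n)$ ($0\le b_1\le\dots\le b_n$) is $\mathcal J$-attacking if for all $1\le i<n$, $b_i\neq0$ implies $b_{i+1}\ge b_i+\mathcal J-1$. For a placement $P$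 of rooks in $B$ with at most one rook per column, a rook $\mathbf r\in P$ $\mathcal J$-attacks a cell $c$ of $B$ if $c$ lies in a column strictly to the right of the column of $\mathbf r$ and $c$ lies in one of the first $\mathcal J$ rows, weakly above the row of $\mathbf r$, that are not $\mathcal J$-attacked by any rook of $P$ lying in a column strictly to the left of $\mathbf r$ (this is determined recursively from left to right). Each rook cancels the cells below it in its column and the cells it $\mathcal J$-attacks. A placement of $k$ rooks is $\mathcal J$-nonattacking if each column contains at most one rook and no rook $\mathcal J$-attacks another rook; $\mathcal N_k^{\mathcal J}(B)$ is the set of these. For $P\in\mathcal N_k^{\mathcal J}(B)$ let $U^{\mathcal J}_B(P)$ be the set of cells of $B$ neither cancelled nor occupied, $r_{(i,j)}(P)$ the number of rooks of $P$ in cells $(i',j')$ with $i'<i$, $j'>j$, and $\mathrm{wt}^{\mathcal J}(P)=\prod_{(i,j)\in U^{\mathcal J}_B(P)}w_{a,b;q,p}\big(\mathcal J(i-1)+1-j-\mathcal J\,r_{(i,j)}(P)\big)$. Then $r^{\mathcal J}_k(a,b;q,p;B)=\sum_{P\in\mathcal N_k^{\mathcal J}(B)}\mathrm{wt}^{\mathcal J}(P)$. *)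

(* Defs.v *)
From HB Require Import structures.
From mathcomp Require Import all_boot all_order all_algebra finmap complex.
From mathcomp Require Import all_classical all_reals all_analysis.

Set Implicit Arguments.
Unset Strict Implicit.
Unset Printing Implicit Defensive.

Import Order.TTheory GRing.Theory Num.Theory.
Import numFieldNormedType.Exports.

Local Open Scope classical_set_scope.
Local Open Scope fset_scope.
Local Open Scope ring_scope.

Section EllipticWeights.
(* Abstract only so that the library's topology on a numFieldType is found
   by inference; these definitions are used with C := R[i]. *)
Context {C : numFieldType}.

Definition theta (x p : C) : C :=
  lim ((fun m : nat =>
          \prod_(0 <= j < m) ((1 - p ^+ j * x) * (1 - p ^+ j.+1 / x))) @ \oo).

Definition thetas (xs : seq C) (p : C) : C := \prod_(x <- xs) theta x p.

Definition weight_den (a b q p : C) (k : int) : C :=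
  thetas [:: a * q ^ (2 * k - 1); b * q ^ (k + 2); a * q ^ k / b] p.

Definition weight (a b q p : C) (k : int) : C :=
  thetas [:: a * q ^ (2 * k + 1); b * q ^ k; a * q ^ (k - 2) / b] p
  / weight_den a b q p k * q.

End EllipticWeights.

Section EllipticNumbers.
Context {R : realType}.
Local Notation C := (complex R).

Definition cexp (z : C) : C :=
  Complex (expR (complex.Re z) * cos (complex.Im z))
          (expR (complex.Re z) * sin (complex.Im z)).

(* The base q is given through a logarithm lam, i.e. q = cexp lam, and
   q^z := cexp (lam * z); any branch of the logarithm is allowed. *)
Definition qpow (lam z : C) : C := cexp (lam * z).

Definition ellnum_den (lam a b p z : C) : C :=
  thetas [:: cexp lam; a * cexp lam;
             b * qpow lam (z + 1); a * qpow lam (z - 1) / b] p.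

(* The elliptic number [z]_{a,b;q,p}. *)
Definition ellnum (lam a b p z : C) : C :=
  thetas [:: qpow lam z; a * qpow lam z; b * cexp lam ^+ 2; a / b] p
  / ellnum_den lam a b p z.

End EllipticNumbers.

(* Cells are pairs (column, row), both numbered from 1; a board with n columns
   only uses the values b 1, ..., b n. *)
Notation cell := (nat * nat)%type.

Definition board (n : nat) (b : nat -> nat) : {fset cell} :=
  [fset c in [seq (i, j) | i <- iota 1 n, j <- iota 1 (b i)]].

Definition ferrers (n : nat) (b : nat -> nat) : Prop :=
  forall i : nat, (1 <= i < n)%N -> (b i <= b i.+1)%N.

Definition attacking_board (J n : nat) (b : nat -> nat) : Prop :=
  ferrers n b /\
  forall i : nat, (1 <= i < n)%N -> b i != 0%N -> (b i + J - 1 <= b i.+1)%N.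

Section Rooks.
Variables (J : nat) (P : {fset cell}).

(* Row t is one of the first J rows, weakly above row r, that satisfy free. *)
Definition among_first (free : pred nat) (r t : nat) : bool :=
  [&& (r <= t)%N, free t & (count free (iota r (t - r)) < J)%N].

(* row_hit i t: row t is J-attacked by a rook in a column strictly left of i. *)
Fixpoint row_hit (i t : nat) : bool :=
  if i is i'.+1 then
    row_hit i' t ||
    has (fun x : cell =>
           (x.1 == i') && among_first (fun u => ~~ row_hit i' u) x.2 t) P
  else false.

Definition attacks (x c : cell) : bool :=
  (x.1 < c.1)%N && among_first (fun u => ~~ row_hit x.1 u) x.2 c.2.

Definition cancels (x c : cell) : bool :=
  ((x.1 == c.1) && (c.2 < x.2)%N) || attacks x c.

Definition nonattacking : bool :=
  all (fun x => all (fun y => (x.1 == y.1) ==> (x == y)) P) P &&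
  all (fun x => all (fun y => ~~ attacks x y) P) P.

Definition uncancelled (B : {fset cell}) : {fset cell} :=
  [fset c in B | (c \notin P) && ~~ has (fun x => cancels x c) P].

Definition nw_rooks (c : cell) : nat :=
  count (fun x : cell => (x.1 < c.1)%N && (c.2 < x.2)%N) P.

End Rooks.

Definition placements (J k : nat) (B : {fset cell}) : {fset {fset cell}} :=
  [fset P in fpowerset B | nonattacking J P && (#|` P| == k)%N].

Section RookNumbers.
Context {C : numFieldType}.

Definition placement_weight (a b q p : C) (J : nat) (B P : {fset cell}) : C :=
  \prod_(c <- uncancelled J P B)
    weight a b q p
      (J%:Z * (c.1%:Z - 1) + 1 - c.2%:Z - J%:Z * (nw_rooks P c)%:Z).

Definition rook_number (a b q p : C) (J k : nat) (B : {fset cell}) : C :=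
  \sum_(P <- placements J k B) placement_weight a b q p J B P.

End RookNumbers.

(* Main.v *)
Require Import Defs.
From mathcomp Require Import all_boot all_order all_algebra finmap complex.
From mathcomp Require Import all_classical all_reals all_analysis.
From mathcomp Require Import showcase.summability.
From mathcomp Require Import zify ring lra.

(* Writing [E s] for the elliptic number at [z - s] with shifted parameters,
   Weierstrass' addition formula gives [E s = 1 + w (s + 1) * E (s + 1)].  The
   board is built column by column: if [k] rooks of a placement lie to the left
   of the new column of height [b], the attacking condition ensures that exactly
   [J * k] of its cells are attacked, and the weights of the [b - J * k] free
   cells, read from the top, are [w (s + 1), w (s + 2), ...] with
   [s = J * n - b].  Iterating the recursion from [s] to [s + b - J * k] is then
   the choice of a rook in the new column (or of none).

   The addition formula is a Pluecker relation as soon as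
   [theta (x * y) * theta (x / y) / x] has the form [g x * f y - f x * g y].
   This follows from the expansion [theta x = c * \sum_k s ^ (k^2 - k) * (- x) ^ k],
   with [s^2 = p] and [c] independent of [x] (a limit of the q-binomial theorem),
   by splitting the double series according to the parity of the sum of the two
   exponents. *)

Import Order.TTheory GRing.Theory Num.Theory.
Local Open Scope ring_scope.

Set Implicit Arguments.
Unset Strict Implicit.
Unset Printing Implicit Defensive.

Import numFieldNormedType.Exports.
Local Open Scope classical_set_scope.
Local Open Scope fset_scope.
Local Open Scope ring_scope.

#[local] Existing Instance totally_filter.

(** * Unordered sums *)

Section UnorderedSums.
Context {K : numFieldType}.

(** Convergence along finite subsets ordered by inclusion. No enumeration of the indices is fixed,
    so series over [int] and [int * int] can be reindexed and split freely. *)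
Definition has_sum (I : choiceType) (f : I -> K) (l : K) :=
  (fun A : {fset I} => \sum_(i <- A) f i) @ totally --> l.

Definition abs_bounded (I : choiceType) (f : I -> K) :=
  exists M, forall A : {fset I}, \sum_(i <- A) `|f i| <= M.

Lemma near_totally (I : choiceType) (A : {fset I}) :
  \forall B \near totally, A `<=` B.
Proof. by exists A. Qed.

Lemma cvg_totally (T : Type) (F : set_system T) (FF : Filter F) (I : choiceType)
    (u : T -> {fset I}) :
  (forall A : {fset I}, \forall t \near F, A `<=` u t) -> u @ F --> totally.
Proof.
move=> uA S [A _ AS]; rewrite /nbhs /=; near=> t; apply: AS => /=.
by near: t; exact: uA.
Unshelve. all: by end_near. Qed.

Lemma has_sum_unique (I : choiceType) (f : I -> K) (l m : K) :
  has_sum f l -> has_sum f m -> l = m.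
Proof. by move=> fl fm; exact: (cvg_unique (@norm_hausdorff K K^o) fl fm). Qed.

Lemma eq_has_sum (I : choiceType) (f g : I -> K) (l : K) :
  has_sum f l -> f =1 g -> has_sum g l.
Proof. by move=> fl /funext <-. Qed.

Lemma has_sumD (I : choiceType) (f g : I -> K) (l m : K) :
  has_sum f l -> has_sum g m -> has_sum (fun i => f i + g i) (l + m).
Proof.
move=> fl gm; rewrite /has_sum; under eq_cvg do rewrite big_split.
exact: cvgD fl gm.
Qed.

Lemma has_sumZ (I : choiceType) (f : I -> K) (l c : K) :
  has_sum f l -> has_sum (fun i => c * f i) (c * l).
Proof.
move=> fl; rewrite /has_sum; under eq_cvg do rewrite -mulr_sumr.
exact: cvgM (cvg_cst c) fl.
Qed.

(** The basic transfer principle: it is applied below to initial segments, symmetric intervals,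
    rectangles and images under bijections. *)
Lemma has_sum_along (T : Type) (F : set_system T) (FF : Filter F)
    (I : choiceType) (f : I -> K) (l : K) (u : T -> {fset I}) :
  has_sum f l -> (forall A : {fset I}, \forall t \near F, A `<=` u t) ->
  (\sum_(i <- u t) f i) @[t --> F] --> l.
Proof. by move=> fl uA; exact: cvg_comp (cvg_totally FF uA) fl. Qed.

Lemma has_sum_reindex (I J : choiceType) (h : J -> I) (g : I -> J)
    (f : I -> K) (l : K) :
  cancel h g -> cancel g h -> has_sum f l -> has_sum (f \o h) l.
Proof.
move=> hK gK fl.
have := @has_sum_along _ totally _ _ _ _ (fun B : {fset J} => [fset h j | j in B]) fl.
have -> : (fun B : {fset J} => \sum_(i <- [fset h j | j in B]) f i) =
          (fun B : {fset J} => \sum_(j <- B) (f \o h) j).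
  by apply/funext => B; rewrite big_imfset //= => i j _ _; exact: can_inj.
apply => A; exists [fset g i | i in A] => //= B gAB; apply/fsubsetP => i iA.
apply/imfsetP; exists (g i); rewrite ?gK //=.
by apply: (fsubsetP gAB); apply/imfsetP; exists i.
Qed.

(** The maps [h true] and [h false] parametrise the two classes of [c]. A finite [B] is cut by [c],
    and each piece, pulled back along [h b], gives an exhausting family of [J]. *)
Lemma has_sum_split (I J : choiceType) (h : bool -> J -> I) (c : I -> bool)
    (g : I -> J) (f : I -> K) (l : bool -> K) :
  (forall b j, c (h b j) = b) -> (forall b, cancel (h b) g) ->
  (forall i, h (c i) (g i) = i) ->
  (forall b, has_sum (f \o h b) (l b)) -> has_sum f (l true + l false).
Proof.
move=> chK hK ghK fl.
pose u (b : bool) (B : {fset I}) := [fset g i | i in [fset i in B | c i == b]].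
have ul (b : bool) : (\sum_(j <- u b B) (f \o h b) j) @[B --> totally] --> l b.
  apply: has_sum_along (fl b) _ => A; exists [fset h b j | j in A] => //= B hAB.
  apply/fsubsetP => j jA; apply/imfsetP; exists (h b j); rewrite ?hK //= !inE /=.
  rewrite chK eqxx andbT; apply: (fsubsetP hAB).
  by apply/imfsetP; exists j.
have uE b B : \sum_(j <- u b B) (f \o h b) j = \sum_(i <- B | c i == b) f i.
  rewrite /u big_imfset /=; last first.
    move=> i j; rewrite !inE /= => /andP[_ /eqP ci] /andP[_ /eqP cj] gij.
    by rewrite -(ghK i) -(ghK j) ci cj gij.
  rewrite big_fset; apply: eq_bigr => i /eqP <-.
  by rewrite /= ghK.
have fE (B : {fset I}) : \sum_(i <- B) f i = \sum_(j <- u true B) (f \o h true) j +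
                               \sum_(j <- u false B) (f \o h false) j.
  rewrite !uE (bigID c) /=.
  by congr (_ + _); apply: eq_bigl => i; case: (c i).
rewrite /has_sum; under eq_cvg do rewrite fE.
exact: cvgD (ul true) (ul false).
Qed.

Lemma ler_sum_fset (I : choiceType) (f : I -> K) (A B : {fset I}) :
  (forall i, 0 <= f i) -> A `<=` B ->
  \sum_(i <- A) f i <= \sum_(i <- B) f i.
Proof.
move=> f0 AB; rewrite [leRHS](big_fsetID _ (mem A)) /=.
have -> : [fset x in B | x \in A] = A.
  by apply/fsetP => x; rewrite !inE /= -(@in_fsetI _ B A) (fsetIidPr AB).
by rewrite lerDl sumr_ge0.
Qed.

Lemma sum_fsetM (I J : choiceType) (f : I -> K) (g : J -> K)
    (A : {fset I}) (B : {fset J}) :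
  \sum_(x <- A `*` B) f x.1 * g x.2 =
  (\sum_(i <- A) f i) * (\sum_(j <- B) g j).
Proof.
rewrite mulr_suml big_imfset2 /=; last by move=> [? ?] [? ?] _ _ /= [-> ->].
by apply: eq_bigr => i _; rewrite mulr_sumr.
Qed.

(** A finite set of pairs lies in the product of its two projections, over which the sum of norms
    factors. *)
Lemma abs_boundedM (I J : choiceType) (f : I -> K) (g : J -> K) :
  abs_bounded f -> abs_bounded g ->
  abs_bounded (fun x : I * J => f x.1 * g x.2).
Proof.
move=> [M fM] [N gN]; exists (M * N) => S.
pose A := [fset x.1 | x in S]; pose B := [fset x.2 | x in S].
have SAB : S `<=` A `*` B.
  apply/fsubsetP => -[i j] ijS; rewrite in_fsetM /=.
  by apply/andP; split; apply/imfsetP; exists (i, j).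
apply: le_trans (ler_sum_fset _ SAB) _ => [x|]; first exact: normr_ge0.
under eq_bigr do rewrite normrM.
rewrite (sum_fsetM (fun i => `|f i|) (fun j => `|g j|)).
by apply: ler_pM; rewrite ?sumr_ge0.
Qed.

(** Rectangles [A * B] exhaust the pairs, so the sums over them tend to [s]; they also factor, so
    they tend to [l * m]. The limit is unique. *)
Lemma has_sumM (I J : choiceType) (f : I -> K) (g : J -> K) (l m s : K) :
  has_sum f l -> has_sum g m ->
  has_sum (fun x : I * J => f x.1 * g x.2) s -> s = l * m.
Proof.
move=> fl gm fgs.
have fg1 : (\sum_(x <- AB.1 `*` AB.2) f x.1 * g x.2)
             @[AB --> filter_prod totally totally] --> s.
  apply: has_sum_along fgs _ => S.
  exists ([set A | [fset x.1 | x in S] `<=` A], [set B | [fset x.2 | x in S] `<=` B]) => /=.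
    by split; exact: near_totally.
  move=> [A B] /= [SA SB]; apply/fsubsetP => -[i j] ijS; rewrite in_fsetM /=.
  apply/andP; split; [apply: (fsubsetP SA)|apply: (fsubsetP SB)];
  by apply/imfsetP; exists (i, j).
have fg2 : (\sum_(x <- AB.1 `*` AB.2) f x.1 * g x.2)
             @[AB --> filter_prod totally totally] --> l * m.
  under eq_cvg do rewrite sum_fsetM.
  have fl' : (fun AB : {fset I} * {fset J} => \sum_(i <- AB.1) f i)
      @ filter_prod totally totally --> l.
    apply: has_sum_along fl _ => A; exists ([set B | A `<=` B], setT) => [|[? ?] []//].
    by split; [exact: near_totally|exact: filterT].
  have gm' : (fun AB : {fset I} * {fset J} => \sum_(j <- AB.2) g j)
      @ filter_prod totally totally --> m.
    apply: has_sum_along gm _ => A; exists (setT, [set B | A `<=` B]) => [|[? ?] []//].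
    by split; [exact: filterT|exact: near_totally].
  exact: cvgM fl' gm'.
exact: (cvg_unique (@norm_hausdorff K K^o) fg1 fg2).
Qed.

End UnorderedSums.

(** * Absolute summability over the real and the complex numbers *)

Section Existence.
Context {R : realType}.
Local Notation C := (complex R).
Local Open Scope complex_scope.

(** Finite sums of nonnegative terms grow with the index set, so they converge to their supremum. *)
Lemma has_sum_nonneg (I : choiceType) (f : I -> R) :
  (forall i, 0 <= f i) -> abs_bounded f -> exists l, has_sum f l.
Proof.
move=> f0 [M fM].
pose S := [set x | exists A : {fset I}, x = \sum_(i <- A) f i].
have supS : has_sup S.
  split; first by exists (\sum_(i <- fset0) f i), fset0.
  exists M => _ [A ->]; apply: le_trans (fM A).
  by apply: ler_sum => i _; exact: ler_norm.
exists (sup S); apply/cvgrPdist_lt => e e0.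
have [_ [A ->] ltA] := sup_adherent e0 supS.
exists A => //= B AB; rewrite ltr_distlC; apply/andP; split.
  by apply: lt_le_trans ltA _; exact: ler_sum_fset.
apply: (@le_lt_trans _ _ (sup S)); last by rewrite ltrDl.
by apply: sup_upper_bound => //; exists B.
Qed.

Lemma abs_bounded_le (K : numFieldType) (I : choiceType) (f g : I -> K) (c : K) :
  0 <= c -> (forall i, `|f i| <= c * `|g i|) -> abs_bounded g -> abs_bounded f.
Proof.
move=> c0 fg [M gM]; exists (c * M) => A.
apply: (@le_trans _ _ (\sum_(i <- A) c * `|g i|)); first exact: ler_sum.
by rewrite -mulr_sumr ler_wpM2l.
Qed.

Lemma has_sum_real (I : choiceType) (f : I -> R) :
  abs_bounded f -> exists l, has_sum f l.
Proof.
move=> bf.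
(* The function is written as the difference of the nonnegative functions [|f| + f] and [|f|]. *)
have [||l fl] := @has_sum_nonneg _ (fun i => `|f i| + f i).
- by move=> i; have := ler_norm (- f i); rewrite normrN; lra.
- apply: (abs_bounded_le (c := 2)) bf => // i.
  by have := ler_normD (`|f i|) (f i); rewrite normr_id; lra.
have [||m fm] := @has_sum_nonneg _ (fun i => `|f i|).
- by move=> i; exact: normr_ge0.
- by apply: (abs_bounded_le (c := 1)) bf => // i; rewrite normr_id mul1r.
exists (l + -1 * m); have := has_sumD fl (has_sumZ (c := -1) fm).
move=> /eq_has_sum; apply => i.
by rewrite mulN1r addrAC subrr add0r.
Qed.

Lemma has_sum_real_complex (I : choiceType) (f : I -> R) (l : R) :
  has_sum f l -> has_sum (fun i => (f i)%:C) l%:C.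
Proof.
move=> fl; apply/cvgrPdist_lt => e e0.
have eR : e = (complex.Re e)%:C by rewrite RRe_real // gtr0_real.
have Re0 : 0 < complex.Re e by rewrite -ltcR -eR.
move/cvgrPdist_lt : fl => /(_ _ Re0); apply: filterS => A.
rewrite -ltcR -eR; apply: le_lt_trans.
by rewrite -rmorph_sum -rmorphB normc_def /= expr0n addr0 sqrtr_sqr.
Qed.

Lemma has_sum_complex (I : choiceType) (f : I -> C) :
  abs_bounded f -> exists l, has_sum f l.
Proof.
move=> [M fM].
have bounded (g : I -> R) : (forall i, `|g i|%:C <= `|f i|) -> abs_bounded g.
  move=> gf; exists (complex.Re M) => A; rewrite -lecR.
  (* A priori [M] is a complex number; it bounds the empty sum, hence is nonnegative and so real. *)
  have MR : M \is Num.real.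
    by apply: ger0_real; apply: le_trans (fM fset0); rewrite sumr_ge0.
  rewrite RRe_real // rmorph_sum; apply: le_trans (fM A).
  by apply: ler_sum => i _; exact: gf.
have [|l fl] := @has_sum_real _ (fun i => complex.Re (f i)).
  by apply: bounded => i; exact: normc_ge_Re.
have [|m fm] := @has_sum_real _ (fun i => complex.Im (f i)).
  (* The imaginary part of [f i] is the real part of [- 'i * f i], which has the same norm as
     [f i]. *)
  apply: bounded => i; apply: le_trans (_ : `|complex.Re (- 'i * f i)|%:C <= _).
    by rewrite mulNr mulrC raddfN /= ReiNIm opprK.
  apply: le_trans (normc_ge_Re _) _.
  by rewrite normrM normrN (normc_def 'i) /= expr0n expr1n add0r sqrtr1 mul1r.
exists (l%:C + 'i * m%:C).
have := has_sumD (has_sum_real_complex fl) (has_sumZ (c := 'i) (has_sum_real_complex fm)).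
move=> /eq_has_sum; apply => i.
by rewrite -complexE.
Qed.

End Existence.

(** * Uniform bounds for products with geometrically decaying perturbations *)

Section GeometricProducts.
Context {R : realType}.
Local Notation C := (complex R).
Local Open Scope complex_scope.

Lemma prod_geometric_real (Y r : R) : 0 <= Y -> 0 <= r < 1 ->
  forall N, \prod_(0 <= j < N) (1 + Y * r ^+ j) <= expR (Y / (1 - r)).
Proof.
move=> Y0 /andP[r0 r1] N.
(* The exponent is strengthened to the partial geometric sum, which makes the induction work: each
   new factor is absorbed by [1 + x <= expR x]. *)
apply: (@le_trans _ _ (expR (Y / (1 - r) * (1 - r ^+ N)))); last first.
  rewrite ler_expR ler_piMr ?divr_ge0 ?subr_ge0 ?(ltW r1) //.
  by rewrite gerBl exprn_ge0.
elim: N => [|N IHN]; first by rewrite big_geq // expr0 subrr mulr0 expR0.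
have -> : Y / (1 - r) * (1 - r ^+ N.+1) =
          Y / (1 - r) * (1 - r ^+ N) + Y * r ^+ N.
  by rewrite exprS; field; rewrite subr_eq0 eq_sym lt_eqF.
rewrite big_nat_recr //= expRD; apply: ler_pM => //; last exact: expR_ge1Dx.
  by apply: prodr_ge0 => i _; rewrite addr_ge0 ?mulr_ge0 ?exprn_ge0.
by rewrite addr_ge0 ?mulr_ge0 ?exprn_ge0.
Qed.

Lemma prod_geometric (Y r : C) : 0 <= Y -> 0 <= r < 1 ->
  exists M, forall N, \prod_(0 <= j < N) (1 + Y * r ^+ j) <= M.
Proof.
move=> Y0 /andP[r0 r1].
have -> : Y = (complex.Re Y)%:C by rewrite RRe_real // ger0_real.
have rE : r = (complex.Re r)%:C by rewrite RRe_real // ger0_real.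
exists (expR (complex.Re Y / (1 - complex.Re r)))%:C => N.
rewrite [in leLHS]rE; under eq_bigr do rewrite -rmorphXn -rmorphM
  -(rmorph1 (real_complex R)) -rmorphD.
rewrite -rmorph_prod lecR; apply: prod_geometric_real.
  by rewrite -ler0c RRe_real // ger0_real.
by rewrite -ler0c -rE r0 -ltcR -rE.
Qed.

End GeometricProducts.

(* The topology of a [numFieldType] is not inferred on [complex R] itself, so the
   analysis is done over an abstract field with the two properties below, which
   [complex R] has by [has_sum_complex] and [prod_geometric]. *)
Definition abs_complete (K : numFieldType) :=
  forall (I : choiceType) (f : I -> K), abs_bounded f -> exists l, has_sum f l.

Definition geometric_bounded (K : numFieldType) :=
  forall Y r : K, 0 <= Y -> 0 <= r < 1 ->
  exists M, forall N, \prod_(0 <= j < N) (1 + Y * r ^+ j) <= M.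

(** * Convergence of infinite products, and dominated convergence of series *)

Section InfiniteProducts.
Context {C : numFieldType}.
Hypothesis C_complete : abs_complete C.
Hypothesis C_geometric : geometric_bounded C.

Lemma sum_geometric (r : C) (N : nat) : 0 <= r < 1 ->
  \sum_(0 <= j < N) r ^+ j <= (1 - r)^-1.
Proof.
move=> /andP[r0 r1]; have r1' : 0 < 1 - r by rewrite subr_gt0.
have /(canRL (mulKf (lt0r_neq0 r1'))) -> :
    (1 - r) * \sum_(0 <= j < N) r ^+ j = 1 - r ^+ N.
  elim: N => [|N IHN]; first by rewrite big_geq // mulr0 expr0 subrr.
  by rewrite big_nat_recr //= mulrDr IHN exprS; ring.
by rewrite ler_piMr ?invr_ge0 ?(ltW r1') // gerBl exprn_ge0.
Qed.

Lemma mem_fset_iota (N j : nat) : (j \in [fset j in iota 0 N]) = (j < N)%N.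
Proof. by rewrite in_fset /= [LHS]mem_iota add0n. Qed.

Lemma sum_fset_iota (K : nmodType) (f : nat -> K) (N : nat) :
  \sum_(j <- [fset j in iota 0 N]) f j = \sum_(0 <= j < N) f j.
Proof.
apply: perm_big; apply: uniq_perm; rewrite ?iota_uniq ?fset_uniq // => j.
by rewrite mem_fset_iota mem_index_iota.
Qed.

Lemma sub_fset_iota (A : {fset nat}) : exists N, A `<=` [fset j in iota 0 N].
Proof.
exists (\big[maxn/0%N]_(i <- A) i).+1; apply/fsubsetP => i iA.
by rewrite mem_fset_iota ltnS (big_fsetD1 i) //= leq_maxl.
Qed.

Lemma abs_bounded_nat (K : numFieldType) (f : nat -> K) (M : K) :
  (forall N, \sum_(0 <= j < N) `|f j| <= M) -> abs_bounded f.
Proof.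
move=> fM; exists M => A; have [N AN] := sub_fset_iota A.
by apply: le_trans (ler_sum_fset _ AN) _ => [?|]; rewrite ?normr_ge0 ?sum_fset_iota.
Qed.

Lemma near_fset_iota (A : {fset nat}) :
  \forall N \near \oo, A `<=` [fset j in iota 0 N].
Proof.
have [M AM] := sub_fset_iota A; exists M => //= N /= MN.
apply: fsubset_trans AM _; apply/fsubsetP => i; rewrite !mem_fset_iota.
by move=> iM; exact: leq_trans MN.
Qed.

Lemma prod1D_bounded (e : nat -> C) (Y r : C) : 0 <= Y -> 0 <= r < 1 ->
  (forall j, `|e j| <= Y * r ^+ j) ->
  exists M, forall N, `|\prod_(0 <= j < N) (1 + e j)| <= M.
Proof.
move=> Y0 r01 eY; have [M MP] := C_geometric Y0 r01.
exists M => N; apply: le_trans (MP N); rewrite normr_prod.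
apply: ler_prod => j _; rewrite normr_ge0 /=; apply: le_trans (ler_normD _ _) _.
by rewrite normr1 lerD2l.
Qed.

(** The partial products telescope: their increments [d n] are a bounded partial product times
    [e n], hence dominated by a geometric series. *)
Lemma prod1D_cvg (e : nat -> C) (Y r : C) : 0 <= Y -> 0 <= r < 1 ->
  (forall j, `|e j| <= Y * r ^+ j) ->
  exists l : C, (\prod_(0 <= j < N) (1 + e j)) @[N --> \oo] --> l.
Proof.
move=> Y0 r01 eY; have [M PM] := prod1D_bounded Y0 r01 eY.
have M0 : 0 <= M by apply: le_trans (PM 0%N); exact: normr_ge0.
pose d n := \prod_(0 <= j < n) (1 + e j) * e n.
have [|l dl] := @C_complete _ d.
  apply: (abs_bounded_nat (M := M * Y * (1 - r)^-1)) => N.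
  apply: le_trans (_ : \sum_(0 <= j < N) M * Y * r ^+ j <= _); last first.
    by rewrite -mulr_sumr ler_wpM2l ?mulr_ge0 ?sum_geometric.
  apply: ler_sum => j _; rewrite normrM -mulrA.
  by apply: ler_pM.
exists (1 + l).
have PE N : \prod_(0 <= j < N) (1 + e j) = 1 + \sum_(j <- [fset j in iota 0 N]) d j.
  rewrite sum_fset_iota; elim: N => [|N IHN]; first by rewrite !big_geq // addr0.
  by rewrite [in RHS]big_nat_recr //= addrA -IHN big_nat_recr //= /d; ring.
under eq_cvg do rewrite PE.
apply: cvgD; first exact: cvg_cst.
exact: (has_sum_along _ dl near_fset_iota).
Qed.

(** Dominated convergence. After [c0] is subtracted from the coefficients, the sum over a large
    finite [A] vanishes in the limit termwise, and the rest is controlled by the tail of the series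
    of norms. *)
Lemma tannery (I : choiceType) (D : nat -> {fset I}) (c : nat -> I -> C)
    (t : I -> C) (c0 K l : C) :
  (forall A : {fset I}, \forall m \near \oo, A `<=` D m) ->
  0 <= K -> (forall m i, `|c m i| <= K) -> (forall i, c ^~ i @ \oo --> c0) ->
  abs_bounded t -> has_sum t l ->
  (\sum_(i <- D m) c m i * t i) @[m --> \oo] --> c0 * l.
Proof.
move=> DA K0 cK cc bt tl.
have [L tL] : exists L, has_sum (fun i => `|t i|) L.
  apply: C_complete; apply: (abs_bounded_le (c := 1)) bt => // i.
  by rewrite normr_id mul1r.
pose K' := K + `|c0|; have K'0 : 0 <= K' by rewrite addr_ge0.
have dK i m : `|c m i - c0| <= K'.
  by apply: le_trans (ler_normB _ _) _; rewrite lerD2r.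
have sumE m : \sum_(i <- D m) c m i * t i =
    \sum_(i <- D m) (c m i - c0) * t i + c0 * \sum_(i <- D m) t i.
  by rewrite mulr_sumr -big_split /=; apply: eq_bigr => i _; ring.
under eq_cvg do rewrite sumE.
rewrite -[c0 * l]add0r; apply: cvgD; last first.
  by apply: cvgM; [exact: cvg_cst|exact: (has_sum_along _ tl DA)].
apply/cvgr0Pnorm_lt => e e0.
(* Chosen so that [(K' + 1) * (d + d) = e / 2]; the [+ 1] keeps the denominator nonzero. *)
pose d := e / (4 * (K' + 1)).
have K'1 : 0 < K' + 1 by rewrite ltr_wpDl.
have d0 : 0 < d by rewrite divr_gt0 ?mulr_gt0.
have /cvgrPdist_lt/(_ _ d0)[A _ Ad] := tL.
have At : (fun m => \sum_(i <- A) (c m i - c0) * t i) @ \oo --> (0 : C).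
  elim: (A : seq I) => [|i r IHr].
    by under eq_cvg do rewrite big_nil; exact: cvg_cst.
  under eq_cvg do rewrite big_cons.
  have cit : (fun m => (c m i - c0) * t i) @ \oo --> (c0 - c0) * t i.
    by apply: cvgM; [apply: cvgB; [exact: cc|exact: cvg_cst]|exact: cvg_cst].
  by have := cvgD cit IHr; rewrite subrr mul0r addr0; apply.
have e2 : 0 < e / 2 by rewrite divr_gt0.
move/cvgr0Pnorm_lt : At => /(_ _ e2) At.
near=> m.
have AD : A `<=` D m by near: m; exact: DA.
rewrite (big_fsetID _ (mem A)) /=.
have -> : [fset x in D m | x \in A] = A.
  by apply/fsetP => x; rewrite !inE /= -(@in_fsetI _ (D m) A) (fsetIidPr AD).
apply: le_lt_trans (ler_normD _ _) _; rewrite [ltRHS](splitr e).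
apply: ltr_leD; first by near: m; exact: At.
set DmA := [fset x in D m | _].
apply: (@le_trans _ _ (K' * \sum_(i <- DmA) `|t i|)).
  rewrite mulr_sumr.
  apply: (@le_trans _ _ (\sum_(i <- DmA) `|(c m i - c0) * t i|)); first exact: ler_norm_sum.
  by apply: ler_sum => i _; rewrite normrM ler_wpM2r.
(* The tail is the difference of two approximation errors of [L], one over [A] and one over [D m],
   each smaller than [d]. *)
have -> : \sum_(i <- DmA) `|t i| =
    `|(L - \sum_(i <- A) `|t i|) - (L - \sum_(i <- D m) `|t i|)|.
  rewrite -[LHS]ger0_norm ?sumr_ge0 //; congr `|_|.
  rewrite [in RHS](big_fsetID _ (mem A) (D m)) /=.
  have -> : [fset x in D m | x \in A] = A.
    by apply/fsetP => x; rewrite !inE /= -(@in_fsetI _ (D m) A) (fsetIidPr AD).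
  by rewrite -/DmA; ring.
have dA := Ad A (fsubset_refl _); have dD := Ad (D m) AD; rewrite /= in dA dD.
have -> : e / 2 = (K' + 1) * (d + d).
  by rewrite /d; field; rewrite lt0r_neq0.
apply: (@le_trans _ _ (K' * (d + d))); last by rewrite ler_wpM2r ?addr_ge0 ?ltW // ltrDl.
rewrite ler_wpM2l //; apply: le_trans (ler_normD _ _) _.
rewrite normrN; exact/ltW/ltrD.
Unshelve. all: by end_near. Qed.

End InfiniteProducts.

(** * Theta functions *)

Section QuadraticSeries.
Context {C : numFieldType}.
Hypothesis C_complete : abs_complete C.
Hypothesis C_geometric : geometric_bounded C.

(** The value 0 is the default when no sum exists; [usumP] gives the meaning in the absolutely
    bounded case. *)
Definition usum (I : choiceType) (f : I -> C) : C := xget 0 [set l | has_sum f l].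

Lemma usumP (I : choiceType) (f : I -> C) : abs_bounded f -> has_sum f (usum f).
Proof. by move=> /C_complete[l fl]; rewrite /usum; case: xgetP => // /(_ l). Qed.

Lemma has_sum_prod (I J : choiceType) (f : I -> C) (g : J -> C) :
  abs_bounded f -> abs_bounded g ->
  has_sum (fun x : I * J => f x.1 * g x.2) (usum f * usum g).
Proof.
move=> bf bg; have [s fgs] := C_complete (abs_boundedM bf bg).
by rewrite -(has_sumM (usumP bf) (usumP bg) fgs).
Qed.

Lemma abs_bounded_int (f : int -> C) :
  abs_bounded (f \o Posz) -> abs_bounded (f \o Negz) -> abs_bounded f.
Proof.
move=> [M fM] [N fN]; exists (M + N) => A.
have part (h : nat -> int) (g : int -> nat) (P : pred int) :
    injective h -> (forall i, P i -> h (g i) = i) ->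
    \sum_(i <- [fset i in A | P i]) `|f i| =
    \sum_(n <- [fset g i | i in [fset i in A | P i]]) `|f (h n)|.
  move=> h_inj hgK; rewrite [RHS]big_imfset /=; last first.
    move=> i j; rewrite !inE /= => /andP[_ Pi] /andP[_ Pj] gij.
    by rewrite -(hgK i) // -(hgK j) // gij.
  by rewrite !big_fset; apply: eq_bigr => i /hgK ->.
rewrite (big_fsetID _ (fun i : int => 0 <= i)) /=; apply: lerD.
  rewrite (part Posz absz) ?fM // => [i j []//|i i0]; exact: gez0_abs.
rewrite (part Negz (fun i => `|i|%N.-1)) ?fN // => [i j []//|i]; lia.
Qed.

(** With [p = s ^+ 2] this is the term [p^(k(k-1)/2) X^k] of the Jacobi theta series; the square
    root [s] avoids halving exponents. *)
Definition qterm (s X : C) (k : int) : C := s ^ (k * k - k) * X ^ k.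

(** The norms satisfy [t n.+1 = |X| * |s|^(2n) * t n]. By induction both [t N] and the sum of [t] up
    to [N] are at most the product [P N], which is bounded. *)
Lemma abs_bounded_qterm_nat (s X : C) : `|s| < 1 ->
  abs_bounded (fun n : nat => s ^+ (n * n.-1) * X ^+ n).
Proof.
move=> s1.
have r01 : 0 <= `|s| ^+ 2 < 1.
  by rewrite exprn_ge0 //= expr_lt1.
have [M PM] := C_geometric (normr_ge0 X) r01.
pose P N := \prod_(0 <= j < N) (1 + `|X| * (`|s| ^+ 2) ^+ j).
pose t n := `|s| ^+ (n * n.-1) * `|X| ^+ n.
have P0 N : 0 <= P N.
  by apply: prodr_ge0 => j _; rewrite addr_ge0 ?mulr_ge0 ?exprn_ge0.
have t0 n : 0 <= t n by rewrite mulr_ge0 ?exprn_ge0.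
have tS n : t n.+1 = `|X| * (`|s| ^+ 2) ^+ n * t n.
  rewrite /t -exprM [X in `|s| ^+ X](_ : _ = (2 * n + n * n.-1)%N); last by case: n => //=; lia.
  by rewrite exprD exprS; ring.
have tP N : t N <= P N.
  elim: N => [|N IHN]; first by rewrite /P big_geq // /t mul0n !expr0 mulr1.
  rewrite tS /P big_nat_recr //= mulrC.
  apply: (ler_pM (t0 N) _ IHN); first by rewrite mulr_ge0 ?exprn_ge0.
  by rewrite lerDr.
have SP N : \sum_(0 <= n < N.+1) t n <= P N.
  elim: N => [|N IHN].
    by rewrite /P big_nat1 big_geq // /t mul0n !expr0 mulr1.
  rewrite big_nat_recr //= tS /P [leRHS]big_nat_recr //= mulrDr mulr1.
  apply: lerD => //; rewrite mulrC; apply: (ler_wpM2r _ (tP N)).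
  by rewrite mulr_ge0 ?exprn_ge0.
apply: (abs_bounded_nat (M := M)) => N.
apply: le_trans (PM N); apply: le_trans (SP N).
rewrite big_nat_recr //= -[leLHS]addr0; apply: lerD => //.
by apply: ler_sum => n _; rewrite normrM !normrX.
Qed.

Lemma abs_bounded_qterm (s X : C) :
  s != 0 -> `|s| < 1 -> X != 0 -> abs_bounded (qterm s X).
Proof.
move=> s0 s1 X0; apply: abs_bounded_int.
  apply: abs_bounded_le (abs_bounded_qterm_nat X s1); first exact: ler01.
  move=> n; rewrite mul1r /= /qterm !exprnP.
  by rewrite [X in s ^ X](_ : _ = Posz (n * n.-1)) //; case: n => //=; lia.
(* For [k = - (n + 1)] the exponent [k * k - k] is [n * (n - 1) + 4 * n + 2], so the term is
   [s ^+ 2 / X] times the [n]-th one at [s ^+ 4 / X]. *)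
apply: abs_bounded_le (abs_bounded_qterm_nat (s ^+ 4 / X) s1).
  exact: (normr_ge0 (s ^+ 2 / X)).
move=> n; rewrite -normrM /= /qterm.
have -> : Negz n * Negz n - Negz n = Posz (n * n.-1 + 4 * n + 2) by case: n => //=; lia.
have -> : X ^ Negz n = X^-1 * X^-1 ^+ n.
  by rewrite NegzE -exprz_inv -exprnP exprS.
rewrite -exprnP exprD (exprD s (n * n.-1) (4 * n)) exprMn -exprM.
by rewrite le_eqVlt; apply/orP; left; apply/eqP; congr `|_|; ring.
Qed.

Lemma exprXz (x : C) (m : nat) (k : int) : (x ^+ m) ^ k = x ^ (m%:Z * k).
Proof. by rewrite exprnP exprz_exp. Qed.

(** Since [(j + l)^2 + (j - l)^2 = 2 j^2 + 2 l^2], the new indices decouple; pairs of this form are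
    those with even sum. The next lemma treats the odd ones. *)
Lemma qtermM_even (s x y : C) (j l : int) : s != 0 -> x != 0 -> y != 0 ->
  qterm s (- (x * y)) (j + l) * qterm s (- (x / y)) (j - l) =
  qterm (s ^+ 2) (x ^+ 2) j * qterm (s ^+ 2) (s ^+ 2 * y ^+ 2) l.
Proof.
move=> s0 x0 y0; rewrite /qterm (expNrz (x * y)) (expNrz (x / y)) (expfzMl x y)
  (expfzMl x y^-1) (expfzMl (s ^+ 2) (y ^+ 2)).
rewrite !exprXz exprz_inv.
have sE : s ^ ((j + l) * (j + l) - (j + l)) * s ^ ((j - l) * (j - l) - (j - l)) =
    s ^ (2 * (j * j - j)) * (s ^ (2 * (l * l - l)) * s ^ (2 * l)).
  by rewrite -!expfzDr //; congr (s ^ _); ring.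
have xE : x ^ (j + l) * x ^ (j - l) = x ^ (2 * j).
  by rewrite -!expfzDr //; congr (x ^ _); ring.
have yE : y ^ (j + l) * y ^ (- (j - l)) = y ^ (2 * l).
  by rewrite -!expfzDr //; congr (y ^ _); ring.
have mE : (-1 : C) ^ (j + l) * (-1) ^ (j - l) = 1.
  rewrite -expfzDr ?oppr_eq0 ?oner_eq0 // (_ : j + l + (j - l) = 2 * j); last by ring.
  by rewrite -exprXz sqrrN expr1n exp1rz.
transitivity ((s ^ ((j + l) * (j + l) - (j + l)) * s ^ ((j - l) * (j - l) - (j - l)))
  * (x ^ (j + l) * x ^ (j - l)) * (y ^ (j + l) * y ^ (- (j - l)))
  * ((-1) ^ (j + l) * (-1) ^ (j - l))); first by ring.
by rewrite sE xE yE mE; ring.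
Qed.

Lemma qtermM_odd (s x y : C) (j l : int) : s != 0 -> x != 0 -> y != 0 ->
  qterm s (- (x * y)) (j + l + 1) * qterm s (- (x / y)) (j - l) =
  - (x * y) *
  (qterm (s ^+ 2) (s ^+ 2 * x ^+ 2) j * qterm (s ^+ 2) (s ^+ 4 * y ^+ 2) l).
Proof.
move=> s0 x0 y0; rewrite /qterm (expNrz (x * y)) (expNrz (x / y)) (expfzMl x y) (expfzMl x y^-1).
rewrite (expfzMl (s ^+ 2) (x ^+ 2)) (expfzMl (s ^+ 4) (y ^+ 2)) !exprXz exprz_inv.
have sE : s ^ ((j + l + 1) * (j + l + 1) - (j + l + 1)) * s ^ ((j - l) * (j - l) - (j - l)) =
    s ^ (2 * (j * j - j)) * s ^ (2 * j) * (s ^ (2 * (l * l - l)) * s ^ (4 * l)).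
  by rewrite -!expfzDr //; congr (s ^ _); ring.
have xE : x ^ (j + l + 1) * x ^ (j - l) = x * x ^ (2 * j).
  by rewrite -[x in RHS]expr1z -!expfzDr //; congr (x ^ _); ring.
have yE : y ^ (j + l + 1) * y ^ (- (j - l)) = y * y ^ (2 * l).
  by rewrite -[y in RHS]expr1z -!expfzDr //; congr (y ^ _); ring.
have mE : (-1 : C) ^ (j + l + 1) * (-1) ^ (j - l) = -1.
  rewrite -expfzDr ?oppr_eq0 ?oner_eq0 // (_ : _ + (j - l) = 2 * j + 1); last by ring.
  rewrite expfzDr ?oppr_eq0 ?oner_eq0 // -exprXz sqrrN expr1n exp1rz.
  by rewrite mul1r expr1z.
transitivity ((s ^ ((j + l + 1) * (j + l + 1) - (j + l + 1)) * s ^ ((j - l) * (j - l) - (j - l)))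
  * (x ^ (j + l + 1) * x ^ (j - l)) * (y ^ (j + l + 1) * y ^ (- (j - l)))
  * ((-1) ^ (j + l + 1) * (-1) ^ (j - l))); first by ring.
by rewrite sE xE yE mE; ring.
Qed.

(** Quasi-periodicity, term by term. It turns the even part's series at [x ^+ 2] into the one at
    [s ^+ 4 * x ^+ 2], so that only two functions occur in the product formula. *)
Lemma qterm_shift (p X : C) (k : int) : p != 0 -> X != 0 ->
  qterm p X (k + 1) = X * qterm p (p ^+ 2 * X) k.
Proof.
move=> p0 X0; rewrite /qterm (expfzMl (p ^+ 2) X) exprXz (expfzDr _ _ X0) expr1z.
rewrite (_ : _ - (k + 1) = (k * k - k) + 2 * k); last by ring.
by rewrite expfzDr //; ring.
Qed.

(** The right side is [x] times an antisymmetric expression in [x] and [y], which is the shape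
    required for the Pluecker relation. *)
Lemma usum_qterm_mul (s x y : C) : s != 0 -> `|s| < 1 -> x != 0 -> y != 0 ->
  usum (qterm s (- (x * y))) * usum (qterm s (- (x / y))) =
  x ^+ 2 * usum (qterm (s ^+ 2) (s ^+ 4 * x ^+ 2)) *
    usum (qterm (s ^+ 2) (s ^+ 2 * y ^+ 2)) -
  x * y * usum (qterm (s ^+ 2) (s ^+ 2 * x ^+ 2)) *
    usum (qterm (s ^+ 2) (s ^+ 4 * y ^+ 2)).
Proof.
move=> s0 s1 x0 y0.
have p0 : s ^+ 2 != 0 by rewrite expf_neq0.
have p1 : `|s ^+ 2| < 1 by rewrite normrX expr_lt1.
have bs X : X != 0 -> abs_bounded (qterm s X) by exact: abs_bounded_qterm.
have bp X : X != 0 -> abs_bounded (qterm (s ^+ 2) X) by exact: abs_bounded_qterm.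
have nz k X : X != 0 -> s ^+ k * X ^+ 2 != 0 by move=> ?; rewrite mulf_neq0 ?expf_neq0.
have shift X : X != 0 ->
    usum (qterm (s ^+ 2) X) = X * usum (qterm (s ^+ 2) (s ^+ 4 * X)).
  move=> X0; have H := @has_sum_reindex _ _ _ (fun k : int => k + 1) (fun k => k - 1) _ _
    (addrK 1) (subrK 1) (usumP (bp X X0)).
  apply: has_sum_unique H _.
  have := has_sumZ (c := X) (usumP (bp (s ^+ 4 * X) _)).
  rewrite mulf_neq0 ?expf_neq0 // => /(_ isT) /eq_has_sum; apply => k.
  by rewrite /= qterm_shift // -exprM.
have xy0 : - (x * y) != 0 by rewrite oppr_eq0 mulf_neq0.
have xVy0 : - (x / y) != 0 by rewrite oppr_eq0 mulf_neq0 ?invr_eq0.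
apply: has_sum_unique (has_sum_prod (bs _ xy0) (bs _ xVy0)) _.
rewrite -(shift (x ^+ 2)) ?expf_neq0 //.
(* [h true] and [h false] enumerate the pairs with even and with odd sum; thanks to floor division
   the single map [g] inverts both. *)
pose h (b : bool) (u : int * int) :=
  if b then (u.1 + u.2, u.1 - u.2) else (u.1 + u.2 + 1, u.1 - u.2).
pose even_sum (u : int * int) := ((u.1 + u.2) %% 2)%Z == 0.
pose g (u : int * int) := (((u.1 + u.2) %/ 2)%Z, ((u.1 - u.2) %/ 2)%Z).
pose l (b : bool) := if b then usum (qterm (s ^+ 2) (x ^+ 2)) *
    usum (qterm (s ^+ 2) (s ^+ 2 * y ^+ 2)) else
  - (x * y) * (usum (qterm (s ^+ 2) (s ^+ 2 * x ^+ 2)) *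
    usum (qterm (s ^+ 2) (s ^+ 4 * y ^+ 2))).
have -> : usum (qterm (s ^+ 2) (x ^+ 2)) * usum (qterm (s ^+ 2) (s ^+ 2 * y ^+ 2)) -
  x * y * usum (qterm (s ^+ 2) (s ^+ 2 * x ^+ 2)) *
    usum (qterm (s ^+ 2) (s ^+ 4 * y ^+ 2)) = l true + l false.
  by rewrite /l; ring.
apply: (@has_sum_split _ _ _ h even_sum g).
- by move=> [] [j k]; rewrite /even_sum /h /=; lia.
- by move=> [] [j k]; rewrite /g /h /=; congr (_, _); lia.
- move=> [j k]; rewrite /g /h /even_sum /=; case: eqP => e /=; congr (_, _); lia.
case.
  have := has_sum_prod (bp (x ^+ 2) _) (bp (s ^+ 2 * y ^+ 2) _).
  rewrite !nz ?expf_neq0 // => /(_ isT isT) /eq_has_sum; apply => -[j k].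
  by rewrite /= qtermM_even.
have := has_sumZ (c := - (x * y)) (has_sum_prod (bp (s ^+ 2 * x ^+ 2) _) (bp (s ^+ 4 * y ^+ 2) _)).
rewrite !nz // => /(_ isT isT) /eq_has_sum; apply => -[j k].
by rewrite /= qtermM_odd.
Qed.

End QuadraticSeries.

(** * The series expansion of theta, from a finite triple product *)

Section ThetaSeries.
Context {C : numFieldType}.
Hypothesis C_complete : abs_complete C.
Hypothesis C_geometric : geometric_bounded C.

Definition qpoch (p : C) (n : nat) : C := \prod_(0 <= j < n) (1 - p ^+ j.+1).

Lemma qpochS (p : C) (n : nat) : qpoch p n.+1 = qpoch p n * (1 - p ^+ n.+1).
Proof. by rewrite /qpoch big_nat_recr. Qed.

Lemma one_sub_exp_neq0 (p : C) (n : nat) : `|p| < 1 -> 1 - p ^+ n.+1 != 0.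
Proof.
move=> p1; rewrite subr_eq0 eq_sym; apply/eqP => /(congr1 Num.norm) /eqP.
by rewrite normrX normr1 lt_eqF // exprn_ilt1.
Qed.

Lemma qpoch_neq0 (p : C) (n : nat) : `|p| < 1 -> qpoch p n != 0.
Proof.
move=> p1; elim: n => [|n IHn]; first by rewrite /qpoch big_geq // oner_neq0.
by rewrite qpochS mulf_neq0 // one_sub_exp_neq0.
Qed.

Lemma norm_exp_sub_le (p : C) (j : nat) : `|p| < 1 ->
  1 - `|p| <= `|1 - p ^+ j.+1|.
Proof.
move=> p1; apply: le_trans (lerB_normD _ _) ; rewrite normr1 normrN normrX.
by rewrite lerD2l lerN2 exprS ler_piMr // exprn_ile1 // ltW.
Qed.

Lemma norm_01 (p : C) : `|p| < 1 -> 0 <= `|p| < 1.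
Proof. by move=> ->; rewrite normr_ge0. Qed.

Lemma norm_expS_le (p : C) (j : nat) : `|p| < 1 -> `|p| ^+ j.+1 <= `|p| ^+ j.
Proof. by move=> p1; rewrite exprS ler_piMl ?exprn_ge0 // ltW. Qed.

Lemma qpoch_limit (p : C) : `|p| < 1 ->
  (exists M, forall n, `|qpoch p n| <= M) /\ (exists l : C, qpoch p @ \oo --> l).
Proof.
move=> p1.
have e j : `|- p ^+ j.+1| <= 1 * `|p| ^+ j.
  by rewrite normrN normrX mul1r norm_expS_le.
split; first exact: (prod1D_bounded C_geometric _ (norm_01 p1) e).
exact: (prod1D_cvg C_complete C_geometric _ (norm_01 p1) e).
Qed.

(** The inverse is again a product of factors [1 + e j] with [e] geometrically small, so the limit
    of [qpoch] need not be shown nonzero. *)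
Lemma qpochV_limit (p : C) : `|p| < 1 ->
  (exists M, forall n, `|(qpoch p n)^-1| <= M) /\
  (exists l : C, (fun n => (qpoch p n)^-1) @ \oo --> l).
Proof.
move=> p1; have r0 : 0 < 1 - `|p| by rewrite subr_gt0.
have r1 : 0 <= (1 - `|p|)^-1 by rewrite invr_ge0 ltW.
pose e j := p ^+ j.+1 / (1 - p ^+ j.+1).
have eP j : `|e j| <= (1 - `|p|)^-1 * `|p| ^+ j.
  rewrite normrM normrX normrV ?unitfE ?one_sub_exp_neq0 // mulrC.
  apply: ler_pM; rewrite ?invr_ge0 ?norm_expS_le //.
  by rewrite lef_pV2 ?posrE ?norm_exp_sub_le // normr_gt0 one_sub_exp_neq0.
have VE n : (qpoch p n)^-1 = \prod_(0 <= j < n) (1 + e j).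
  elim: n => [|n IHn]; first by rewrite /qpoch !big_geq // invr1.
  rewrite qpochS invfM IHn big_nat_recr //=; congr (_ * _).
  by rewrite /e; field; exact: one_sub_exp_neq0.
have [M MP] := prod1D_bounded C_geometric r1 (norm_01 p1) eP.
have [l lP] := prod1D_cvg C_complete C_geometric r1 (norm_01 p1) eP.
split; [exists M => n|exists l]; first by rewrite VE.
by under eq_cvg do rewrite VE.
Qed.

(** The q-binomial theorem in base [s ^+ 2], by induction on [N] through the q-Pascal rule. *)
Lemma qbinomial (s y : C) (N : nat) : `|s| < 1 ->
  \prod_(0 <= i < N) (1 + (s ^+ 2) ^+ i * y) =
  \sum_(0 <= n < N.+1) qpoch (s ^+ 2) N / qpoch (s ^+ 2) n /
    qpoch (s ^+ 2) (N - n) * (s ^+ (n * n.-1) * y ^+ n).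
Proof.
move=> s1; set p := s ^+ 2.
have p1 : `|p| < 1 by rewrite normrX expr_lt1.
have P0 n : qpoch p n != 0 by exact: qpoch_neq0.
have Q1 : qpoch p 0 = 1 by rewrite /qpoch big_geq.
have sS n : s ^+ (n.+1 * n) = p ^+ n * s ^+ (n * n.-1).
  rewrite /p -exprM -exprD; congr (s ^+ _); case: n => //=; lia.
elim: N => [|N IHN].
  by rewrite big_geq // big_nat1 Q1 mul0n !expr0; field.
rewrite big_nat_recr //= IHN mulrDr mulr1.
(* The two extreme terms are split off; each inner one is the sum of two terms from the induction
   hypothesis. *)
rewrite [X in X + _]big_nat_recl // [X in _ + X * _]big_nat_recr //=.
rewrite [RHS]big_nat_recl // [in RHS]big_nat_recr //=.
rewrite mulrDl mulr_suml !subn0 !subnn Q1 mul0n !expr0 sS exprS.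
rewrite -addrA [X in _ + X]addrA -big_split /=.
congr (_ + (_ + _)); [by field; rewrite !P0| |by field; rewrite !P0].
rewrite !big_nat; apply: eq_bigr => n /andP[_ nN].
rewrite sS exprS; have [d ->] : exists d, N = (n + d).+1.
  by exists (N - n.+1)%N; lia.
rewrite (_ : (n + d).+1 - n = d.+1)%N; last by lia.
rewrite (_ : (n + d).+1 - n.+1 = d)%N; last by lia.
rewrite (_ : (n + d).+2 - n.+1 = d.+1)%N; last by lia.
rewrite (_ : p ^+ (n + d).+1 = p ^+ n * p ^+ d.+1); last by rewrite -addnS exprD.
rewrite (qpochS p (n + d).+1) (qpochS p n) (qpochS p d).
rewrite (_ : p ^+ (n + d).+2 = p * p ^+ n * p ^+ d.+1); last first.
  by rewrite -exprS -exprD; congr (p ^+ _); lia.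
have n0 := one_sub_exp_neq0 n p1; have d0 := one_sub_exp_neq0 d p1.
rewrite (exprS p n) in n0 *.
move: (P0 (n + d).+1) (P0 n) (P0 d) n0 d0.
move: (qpoch p _) (qpoch p n) (qpoch p d) (p ^+ n) (p ^+ d.+1) (s ^+ _) (y ^+ n).
move=> A B D u v S Y A0 B0 D0 n0 d0.
by field; rewrite ?B0 ?D0 ?n0 ?d0.
Qed.

Definition theta_trunc (x p : C) (m : nat) : C :=
  \prod_(0 <= j < m) ((1 - p ^+ j * x) * (1 - p ^+ j.+1 / x)).

(** With [p = s ^+ 2], the factors with [i >= m] are [1 - p^(i-m) x]. Those with [i < m] are
    [- x / p^(m-i)] times [1 - p^(m-i) / x], and these prefactors multiply to the last term. *)
Lemma theta_trunc_shift (s x : C) (m : nat) : s != 0 -> x != 0 ->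
  \prod_(0 <= i < m.*2) (1 + (s ^+ 2) ^+ i * - (x / (s ^+ 2) ^+ m)) =
  theta_trunc x (s ^+ 2) m * ((- x) ^+ m / s ^+ (m * m.+1)).
Proof.
move=> s0 x0; set p := s ^+ 2; have p0 : p != 0 by rewrite expf_neq0.
elim: m => [|m IHm].
  by rewrite /theta_trunc !big_geq // mul0n !expr0 divr1 mulr1.
rewrite doubleS big_nat_recr //= big_nat_recl //= mulrAC.
have -> : \prod_(0 <= i < m.*2) (1 + p ^+ i.+1 * - (x / p ^+ m.+1)) =
          \prod_(0 <= i < m.*2) (1 + p ^+ i * - (x / p ^+ m)).
  apply: eq_bigr => i _; congr (1 + _); rewrite !exprS.
  by field; rewrite p0 expf_neq0.
rewrite IHm /theta_trunc big_nat_recr //=.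
have -> : p ^+ m.*2.+1 = p ^+ m.+1 * p ^+ m by rewrite -exprD; congr (p ^+ _); lia.
have -> : s ^+ (m.+1 * m.+2) = p ^+ m.+1 * s ^+ (m * m.+1).
  by rewrite /p -exprM -exprD; congr (s ^+ _); lia.
rewrite !expr0 [(- x) ^+ m.+1]exprS.
have pm0 : p ^+ m.+1 != 0 by rewrite expf_neq0.
have sm0 : s ^+ (m * m.+1) != 0 by rewrite expf_neq0.
move: (p ^+ m.+1) (p ^+ m) (s ^+ _) ((- x) ^+ m) pm0 sm0 => u v S X u0 S0.
by field; rewrite u0 S0 x0.
Qed.

(** For [|k| <= m] this is the Gaussian binomial coefficient of [2m] over [m + k]. Elsewhere the
    value is arbitrary but bounded, as [tannery] asks for a bound at all [k]. *)
Definition theta_coef (p : C) (m : nat) (k : int) : C :=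
  qpoch p m.*2 * (qpoch p (absz (m%:Z + k)))^-1 * (qpoch p (m.*2 - absz (m%:Z + k)%R)%N)^-1.

Definition theta_range (m : nat) : {fset int} :=
  [fset n%:Z - m%:Z | n in [fset n in iota 0 m.*2.+1]].

Lemma near_theta_range (A : {fset int}) : \forall m \near \oo, A `<=` theta_range m.
Proof.
have [M AM] := sub_fset_iota [fset `|k|%N | k in A].
exists M => //= m /= Mm; apply/fsubsetP => k kA.
have : `|k|%N \in [fset `|k|%N | k in A] by apply/imfsetP; exists k.
move=> /(fsubsetP AM); rewrite mem_fset_iota => kM.
have km : absz (k + m%:Z) \in [fset n in iota 0 m.*2.+1].
  by rewrite mem_fset_iota; lia.
by apply/imfsetP; exists (absz (k + m%:Z)) => //; lia.
Qed.

(** A finite Jacobi triple product: [qbinomial] with [2m] factors at [- x / p^m], reindexed by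
    [n = m + k]. *)
Lemma theta_truncE (s x : C) (m : nat) : s != 0 -> `|s| < 1 -> x != 0 ->
  theta_trunc x (s ^+ 2) m =
  \sum_(k <- theta_range m) theta_coef (s ^+ 2) m k * qterm s (- x) k.
Proof.
move=> s0 s1 x0; have xN0 : - x != 0 by rewrite oppr_eq0.
have := theta_trunc_shift m s0 x0; rewrite qbinomial // => H.
have D0 : (- x) ^+ m / s ^+ (m * m.+1) != 0.
  by rewrite mulf_neq0 ?invr_eq0 ?expf_neq0.
apply: (mulIf D0); rewrite -H mulr_suml big_imfset; last first.
  by move=> i j _ _ /= /(congr1 (fun k => k + m%:Z)); rewrite !subrK => -[].
rewrite sum_fset_iota; apply: eq_bigr => n _; rewrite /theta_coef.
rewrite (_ : absz (m%:Z + (n%:Z - m%:Z)) = n); last by lia.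
rewrite -[RHS]mulrA; congr (_ * _).
rewrite -mulNr exprMn exprVn -exprM -exprM /qterm.
rewrite (_ : _ - (n%:Z - m%:Z) =
  (n * n.-1)%:Z + (m * m.+1)%:Z - (2 * m * n)%:Z); last by case: (n) => //=; lia.
rewrite !expfzDr // -!exprnP -!exprnN.
by field; rewrite !expf_neq0.
Qed.

Lemma cvg_nat_infty (u : nat -> nat) :
  (forall N, exists M, forall m, (M <= m)%N -> (N <= u m)%N) -> u @ \oo --> \oo.
Proof.
by move=> uP S [N _ NS]; have [M MP] := uP N; exists M => // m /MP /NS.
Qed.

Lemma theta_coef_bounded (p : C) : `|p| < 1 ->
  exists2 K, 0 <= K & forall m k, `|theta_coef p m k| <= K.
Proof.
move=> p1; have [[M PM] _] := qpoch_limit p1; have [[N VN] _] := qpochV_limit p1.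
have M0 : 0 <= M by apply: le_trans (PM 0%N); exact: normr_ge0.
have N0 : 0 <= N by apply: le_trans (VN 0%N); exact: normr_ge0.
exists (M * N * N); first by rewrite !mulr_ge0.
by move=> m k; rewrite !normrM !ler_pM ?mulr_ge0.
Qed.

(** The indices [2m], [m + k] and [m - k] all tend to infinity with [m], hence a limit independent
    of [k]. *)
Lemma theta_coef_cvg (p : C) : `|p| < 1 ->
  exists c : C, forall k, theta_coef p ^~ k @ \oo --> c.
Proof.
move=> p1; have [_ [l Pl]] := qpoch_limit p1; have [_ [v Vv]] := qpochV_limit p1.
exists (l * v * v) => k; apply: cvgM; first apply: cvgM.
- apply: (cvg_comp _ _ _ Pl); apply: cvg_nat_infty => N; exists N => m; lia.
- apply: (cvg_comp (fun m : nat => absz (m%:Z + k)) _ _ Vv).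
  apply: cvg_nat_infty => N; exists (N + `|k|)%N => m; lia.
- have H : (fun m : nat => m.*2 - absz (m%:Z + k)%R)%N @ \oo --> \oo.
    by apply: cvg_nat_infty => N; exists (N + `|k|)%N => m; lia.
  exact: (cvg_comp _ _ H Vv).
Qed.

Lemma thetaE (s : C) : s != 0 -> `|s| < 1 ->
  exists c, forall x, x != 0 -> theta x (s ^+ 2) = c * usum (qterm s (- x)).
Proof.
move=> s0 s1; have p1 : `|s ^+ 2| < 1 by rewrite normrX expr_lt1.
have [K K0 cK] := theta_coef_bounded p1; have [c cc] := theta_coef_cvg p1.
exists c => x x0; have bx : abs_bounded (qterm s (- x)).
  by apply: abs_bounded_qterm; rewrite ?oppr_eq0.
have := tannery C_complete near_theta_range K0 cK cc bx (usumP C_complete bx).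
under eq_cvg do rewrite -theta_truncE //.
exact: (@cvg_lim C^o (@norm_hausdorff C C^o)).
Qed.

Lemma theta_p0 (x : C) : x != 0 -> theta x 0 = 1 - x.
Proof.
move=> x0; apply: (@cvg_lim C^o (@norm_hausdorff C C^o)).
apply: cvg_near_cst; exists 1%N => // -[//|m] _ /=.
rewrite big_nat_recl //= big1 ?mulr1 => [|j _].
  by rewrite expr0 expr1 mul0r subr0 mul1r mulr1.
by rewrite !exprS !mul0r subr0 mulr1.
Qed.

Lemma theta_mul (p : C) : `|p| < 1 -> (exists s, p = s ^+ 2) ->
  exists f g : C -> C, forall x y, x != 0 -> y != 0 ->
  theta (x * y) p * theta (x / y) p = x * (g x * f y - f x * g y).
Proof.
move=> + [s pE]; rewrite {}pE; have [-> _|s0] := eqVneq s 0.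
  exists (fun=> 1), (fun x => x + x^-1) => x y x0 y0.
  rewrite expr0n /= !theta_p0 ?mulf_neq0 ?invr_eq0 //.
  by field; rewrite x0 y0.
rewrite normrX expr_lt1 // => s1; have [c cE] := thetaE s0 s1.
exists (fun x => c * usum (qterm (s ^+ 2) (s ^+ 2 * x ^+ 2))).
exists (fun x => c * x * usum (qterm (s ^+ 2) (s ^+ 4 * x ^+ 2))) => x y x0 y0.
rewrite !cE ?mulf_neq0 ?invr_eq0 // mulrACA usum_qterm_mul //.
by ring.
Qed.

End ThetaSeries.

(** * Elliptic numbers *)

(** By [theta_mul] each pair of thetas is a 2 by 2 determinant times its first variable. The factor
    [u / y] gives all three products the prefactor [x * u], leaving the Pluecker relation. *)
Lemma theta_addition (C : numFieldType) (p x y u v : C) :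
  abs_complete C -> geometric_bounded C -> `|p| < 1 -> (exists s, p = s ^+ 2) ->
  x != 0 -> y != 0 -> u != 0 -> v != 0 ->
  theta (x * y) p * theta (x / y) p * (theta (u * v) p * theta (u / v) p) -
    u / y * (theta (y * v) p * theta (y / v) p * (theta (x * u) p * theta (x / u) p)) =
  theta (u * y) p * theta (u / y) p * (theta (x * v) p * theta (x / v) p).
Proof.
move=> Cc Cg p1 ps x0 y0 u0 v0; have [f [g fg]] := theta_mul Cc Cg p1 ps.
by rewrite !fg //; field.
Qed.

(** * The recursion of elliptic numbers from an abstract addition formula *)

Section EllipticFunctional.
Context {F : fieldType} (th : F -> F).
Hypothesis th_addition : forall x y u v, x != 0 -> y != 0 -> u != 0 -> v != 0 ->
  th (x * y) * th (x / y) * (th (u * v) * th (u / v)) -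
    u / y * (th (y * v) * th (y / v) * (th (x * u) * th (x / u))) =
  th (u * y) * th (u / y) * (th (x * v) * th (x / v)).

(** Here [Z] stands for [q^z] and [t] for [q^s], so that every theta argument is a monomial. *)
Definition ellden (a b q Z t : F) : F :=
  th q * th (a * t ^+ 2 * q) * (th (b * Z * q) * th (a * Z / (q * b))).

Definition ellnum_at (a b q Z t : F) : F :=
  th (Z / t) * th (a * t * Z) * (th (b * t * q ^+ 2) * th (a * t / b)) /
  ellden a b q Z t.

Definition weight_at_den (a b q t : F) : F :=
  th (a * t ^+ 2 * q) * (th (b * t * q ^+ 3) * th (a * t * q / b)).

Definition weight_at (a b q t : F) : F :=
  th (a * t ^+ 2 * q ^+ 3) * (th (b * t * q) * th (a * t / (q * b))) /
  weight_at_den a b q t * q.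

Lemma ellnum_at_rec (r b q Z t : F) :
  r != 0 -> b != 0 -> q != 0 -> Z != 0 -> t != 0 ->
  weight_at_den (r ^+ 2) b q t != 0 -> ellden (r ^+ 2) b q Z t != 0 ->
  ellden (r ^+ 2) b q Z (t * q) != 0 ->
  ellnum_at (r ^+ 2) b q Z t =
  1 + weight_at (r ^+ 2) b q t * ellnum_at (r ^+ 2) b q Z (t * q).
Proof.
move=> r0 b0 q0 Z0 t0.
(* The addition formula is taken at [x = r Z], [y = r t], [u = r t q], [v = b q / r]: the pairwise
   products and quotients are then the theta arguments of the recursion, with [a = r ^+ 2]. *)
have x0 : r * Z != 0 by rewrite mulf_neq0.
have y0 : r * t != 0 by rewrite mulf_neq0.
have u0 : r * t * q != 0 by rewrite mulf_neq0.
have v0 : b * q / r != 0 by rewrite mulf_neq0 ?invr_eq0 // mulf_neq0.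
have := th_addition x0 y0 u0 v0.
rewrite /ellnum_at /weight_at /ellden /weight_at_den.
have -> : r * Z * (r * t) = r ^+ 2 * t * Z by ring.
have -> : r * Z / (r * t) = Z / t by field; rewrite r0 t0.
have -> : r * t * q * (b * q / r) = b * t * q ^+ 2 by field.
have -> : r * t * q / (b * q / r) = r ^+ 2 * t / b by field; rewrite r0 b0 q0.
have -> : r * t * (b * q / r) = b * t * q by field.
have -> : r * t / (b * q / r) = r ^+ 2 * t / (q * b) by field; rewrite r0 b0 q0.
have -> : r * Z * (r * t * q) = r ^+ 2 * (t * q) * Z by ring.
have -> : r * Z / (r * t * q) = Z / (t * q) by field; rewrite r0 t0 q0.
have -> : r * t * q * (r * t) = r ^+ 2 * t ^+ 2 * q by ring.
have -> : r * t * q / (r * t) = q by field; rewrite r0 t0.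
have -> : r * Z * (b * q / r) = b * Z * q by field.
have -> : r * Z / (b * q / r) = r ^+ 2 * Z / (q * b) by field; rewrite r0 b0 q0.
have -> : b * (t * q) * q ^+ 2 = b * t * q ^+ 3 by ring.
have -> : r ^+ 2 * (t * q) / b = r ^+ 2 * t * q / b by ring.
have -> : r ^+ 2 * (t * q) ^+ 2 * q = r ^+ 2 * t ^+ 2 * q ^+ 3 by ring.
move: (th _) (th _) (th _) (th _) (th _) (th _) (th _) (th _) (th _) (th _) (th _) (th _) (th _) (th _) (th _).
move=> T0 T1 T2 T3 T4 T5 T6 T7 T8 T9 T10 T11 T12 T13 T14 add.
rewrite !mulf_eq0 !negb_or => /and3P[n6 n2 n1] /andP[/andP[n5 _] /andP[n4 n3]].
move=> /andP[/andP[_ n0] _].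
(* The second product of the addition formula is subtracted and added back, where [u / y] has become
   [q]. *)
rewrite [T13 * T14]mulrC -[T14 * _ * _](subrK (q * (T10 * T9 * (T8 * T7)))) add.
by field; rewrite n0 n1 n2 n3 n4 n5 n6.
Qed.

End EllipticFunctional.

Section Arguments.
Context {F : fieldType}.

Lemma den_arg1 (b t Z q : F) : t != 0 -> b * t * (Z / t) * q = b * Z * q.
Proof. by move=> t0; field. Qed.

Lemma den_arg2 (a b t Z q : F) : b != 0 -> t != 0 -> q != 0 ->
  a * t ^+ 2 * (Z / t / q) / (b * t) = a * Z / (q * b).
Proof. by move=> b0 t0 q0; field; rewrite q0 b0 t0. Qed.

Lemma num_arg1 (a t Z : F) : t != 0 -> a * t ^+ 2 * (Z / t) = a * t * Z.
Proof. by move=> t0; field. Qed.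

Lemma num_arg2 (a b t : F) : b != 0 -> t != 0 ->
  a * t ^+ 2 / (b * t) = a * t / b.
Proof. by move=> b0 t0; field; rewrite b0 t0. Qed.

End Arguments.

Section Weights.
Context {C : numFieldType}.

Lemma weight_denE (a b q p : C) (s : int) : q != 0 ->
  weight_den a b q p (s + 1) = weight_at_den (theta ^~ p) a b q (q ^ s).
Proof.
move=> q0; rewrite /weight_den /thetas !big_cons big_nil mulr1.
rewrite (_ : 2 * (s + 1) - 1 = s * 2 + 1); last by ring.
rewrite -[s + 1 + 2]addrA !expfzDr // -exprz_exp -!exprnP expr1 /weight_at_den.
by rewrite -!mulrA.
Qed.

Lemma weightE (a b q p : C) (s : int) : q != 0 ->
  weight a b q p (s + 1) = weight_at (theta ^~ p) a b q (q ^ s).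
Proof.
move=> q0; rewrite /weight weight_denE // /weight_at; congr (_ / _ * _).
rewrite /thetas !big_cons big_nil mulr1.
rewrite (_ : 2 * (s + 1) + 1 = s * 2 + 3); last by ring.
rewrite (_ : s + 1 - 2 = s - 1); last by ring.
rewrite !expfzDr // -exprz_exp -!exprnP exprN1 expr1 invfM.
by rewrite -!mulrA.
Qed.

End Weights.

Section EllipticRecursion.
Context {R : realType}.
Local Notation C := (complex R).

Lemma cexpD (z w : C) : cexp (z + w) = cexp z * cexp w.
Proof.
case: z w => [a b] [c d]; rewrite /cexp /= expRD cosD sinD.
by apply/eqP; rewrite eq_complex /=; apply/andP; split; apply/eqP; ring.
Qed.

Lemma cexp0 : cexp (0 : C) = 1.
Proof. by rewrite /cexp /= expR0 cos0 sin0 mulr1 mulr0. Qed.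

Lemma cexp_neq0 (z : C) : cexp z != 0.
Proof.
apply/eqP => z0; have := cexpD z (- z); rewrite subrr cexp0 z0 mul0r => /eqP.
by rewrite oner_eq0.
Qed.

Lemma cexpN (z : C) : cexp (- z) = (cexp z)^-1.
Proof.
by apply: (mulfI (cexp_neq0 z)); rewrite -cexpD subrr cexp0 divff ?cexp_neq0.
Qed.

Lemma cexp_natz (lam : C) (n : nat) : cexp (lam * n%:R) = cexp lam ^+ n.
Proof.
elim: n => [|n IHn]; first by rewrite mulr0 cexp0.
by rewrite exprSr -IHn -cexpD -natr1 mulrDr mulr1.
Qed.

Lemma cexp_intz (lam : C) (k : int) : cexp (lam * k%:~R) = cexp lam ^ k.
Proof.
case: k => n; first exact: cexp_natz.
by rewrite NegzE mulrNz mulrN cexpN cexp_natz.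
Qed.

Lemma qpow_shift (lam z : C) (s : int) :
  qpow lam (z - s%:~R) = qpow lam z / cexp lam ^ s.
Proof. by rewrite /qpow mulrDr mulrN cexpD cexpN cexp_intz. Qed.

Lemma qpow_add1 (lam z : C) : qpow lam (z + 1) = qpow lam z * cexp lam.
Proof. by rewrite /qpow mulrDr mulr1 cexpD. Qed.

Lemma qpow_sub1 (lam z : C) : qpow lam (z - 1) = qpow lam z / cexp lam.
Proof. by rewrite /qpow mulrDr mulrN1 cexpD cexpN. Qed.

Lemma ellnum_denE (a b q p lam z : C) (s : int) : b != 0 -> q = cexp lam ->
  ellnum_den lam (a * q ^ (2 * s)) (b * q ^ s) p (z - s%:~R) =
  ellden (theta ^~ p) a b q (qpow lam z) (q ^ s).
Proof.
move=> b0 qE; have q0 : q != 0 by rewrite qE cexp_neq0.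
have t0 : q ^ s != 0 by rewrite expfz_neq0.
rewrite /ellnum_den /thetas !big_cons big_nil mulr1.
rewrite qpow_add1 qpow_sub1 qpow_shift -qE /ellden.
rewrite [2 * s]mulrC -exprz_exp -exprnP.
move: (q ^ s) (qpow lam z) t0 => t Z t0.
rewrite (mulrA (b * t)) den_arg1 // den_arg2 //.
by rewrite -!mulrA.
Qed.

Lemma ellnumE (a b q p lam z : C) (s : int) : b != 0 -> q = cexp lam ->
  ellnum lam (a * q ^ (2 * s)) (b * q ^ s) p (z - s%:~R) =
  ellnum_at (theta ^~ p) a b q (qpow lam z) (q ^ s).
Proof.
move=> b0 qE; rewrite /ellnum ellnum_denE // /ellnum_at; congr (_ / _).
have q0 : q != 0 by rewrite qE cexp_neq0.
have t0 : q ^ s != 0 by rewrite expfz_neq0.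
rewrite /thetas !big_cons big_nil mulr1 qpow_shift -qE.
rewrite [2 * s]mulrC -exprz_exp -exprnP.
move: (q ^ s) (qpow lam z) t0 => t Z t0.
rewrite num_arg1 // num_arg2 //.
by rewrite -!mulrA.
Qed.

Lemma ellnum_rec (a b q p lam z : C) (s : int) :
  a != 0 -> b != 0 -> `|p| < 1 -> q = cexp lam ->
  weight_den a b q p (s + 1) != 0 ->
  (forall s : int, ellnum_den lam (a * q ^ (2 * s)) (b * q ^ s) p (z - s%:~R) != 0) ->
  ellnum lam (a * q ^ (2 * s)) (b * q ^ s) p (z - s%:~R) =
  1 + weight a b q p (s + 1) *
    ellnum lam (a * q ^ (2 * (s + 1))) (b * q ^ (s + 1)) p (z - (s + 1)%:~R).
Proof.
move=> a0 b0 p1 qE w0 d0; have q0 : q != 0 by rewrite qE cexp_neq0.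
(* The substitution into the addition formula involves a square root of [a]. *)
have [r rE] : exists r, a = r ^+ 2 by exists (sqrtc a); rewrite sqr_sqrtc.
have r0 : r != 0 by apply: contraNneq a0 => r0; rewrite rE r0 expr0n.
have := d0 (s + 1); have := d0 s; move: w0.
rewrite !ellnumE // !ellnum_denE // weightE // weight_denE // rE expfzDr // expr1z.
move=> w0 e0 e1; apply: (@ellnum_at_rec _ (theta ^~ p)) => //.
- move=> x y u v x0 y0 u0 v0; apply: theta_addition => //.
  + exact: has_sum_complex.
  + exact: prod_geometric.
  + by exists (sqrtc p); rewrite sqr_sqrtc.
- exact: cexp_neq0.
- exact: expfz_neq0.
Qed.

End EllipticRecursion.

(** * Rook placements *)

Section AmongFirst.
Local Open Scope nat_scope.
Variables (J : nat) (free : pred nat).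

Lemma count_among_first (r N : nat) :
  count (among_first J free r) (iota r N) = minn J (count free (iota r N)).
Proof.
elim: N => [|N IHN]; first by rewrite /= minn0.
rewrite -addn1 iotaD !count_cat IHN /= !addn0 /among_first leq_addr addKn /=.
by case: (free _) => /=; lia.
Qed.

(** A free row [j] above [r] that is not chosen has [J] free rows between [r] and it, so nothing
    higher is chosen. *)
Lemma among_first_le (r j t : nat) :
  r <= j -> free j -> ~~ among_first J free r j -> among_first J free r t -> t <= j.
Proof.
move=> rj fj; rewrite /among_first rj fj /= -leqNgt => Jj /and3P[rt ft tJ].
rewrite leqNgt; apply/negP => jt; move: tJ; rewrite ltnNge => /negP; apply.
apply: leq_trans Jj _; rewrite (_ : t - r = (j - r) + (t - j)); last by lia.
by rewrite iotaD count_cat leq_addr.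
Qed.

(** Only the row [r] and the rows above [b] are counted. *)
Lemma count_free_above (r b N : nat) : r <= b -> free r ->
  (forall t, b < t -> free t) -> b < r + N ->
  r + N - b <= count free (iota r N).
Proof.
move=> rb fr fb bN; rewrite (_ : N = 1 + (b - r) + (r + N - b).-1); last by lia.
rewrite !iotaD !count_cat /= fr addn0 -addnA.
have -> : count free (iota (r + (1 + (b - r))) (r + N - b).-1) = (r + N - b).-1.
  rewrite -[RHS](size_iota (r + (1 + (b - r)))); apply/eqP; rewrite -all_count.
  by apply/allP => t; rewrite mem_iota => t_range; apply: fb; lia.
lia.
Qed.

End AmongFirst.

(** * Rows attacked in a given column, and their number *)

Section Hits.
Local Open Scope nat_scope.
Variable J : nat.
Implicit Types (P Q : {fset cell}) (c x : cell) (i j t : nat).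

Lemma row_hitE P i t : row_hit J P i t = has (fun x => attacks J P x (i, t)) P.
Proof.
elim: i => [|i IHi]; first by apply/esym/negbTE/hasPn => x _.
rewrite [LHS]/= IHi -has_predU; apply: eq_has => x; rewrite /= /attacks /= ltnS.
case: ltngtP => [lt|gt|->] //=; first by rewrite orbF.
Qed.

(** Attacks in column [i] depend only on the rooks to its left, so a rook added in a later column
    does not disturb them. *)
Lemma row_hit_eq P Q i t :
  (forall x, x.1 < i -> (x \in P) = (x \in Q)) -> row_hit J P i t = row_hit J Q i t.
Proof.
elim: i t => //= i IHi t PQ.
have IH u : row_hit J P i u = row_hit J Q i u.
  by apply: IHi => x xi; apply: PQ; apply: ltnW.
rewrite IH; congr (_ || _).
have E r : among_first J (fun u => ~~ row_hit J P i u) r t =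
           among_first J (fun u => ~~ row_hit J Q i u) r t.
  by rewrite /among_first IH; under eq_count do rewrite IH.
apply/hasP/hasP => -[x xP /andP[xi xt]]; exists x; rewrite ?xi /=.
- by rewrite -PQ // (eqP xi).
- by rewrite -E.
- by rewrite PQ // (eqP xi).
- by rewrite E.
Qed.

Lemma nonattackingP P :
  reflect ((forall x y, x \in P -> y \in P -> x.1 = y.1 -> x = y) /\
           (forall y, y \in P -> ~~ row_hit J P y.1 y.2))
          (nonattacking J P).
Proof.
apply: (iffP andP) => -[uP aP]; split.
- move=> x y xP yP xy; move/allP : uP => /(_ x xP)/allP/(_ y yP).
  by rewrite xy eqxx => /eqP.
- move=> y yP; rewrite row_hitE; apply/hasPn => x xP.
  by move/allP : aP => /(_ x xP)/allP/(_ y yP); case: (y).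
- apply/allP => x xP; apply/allP => y yP; apply/implyP => /eqP xy.
  by apply/eqP; exact: uP.
- apply/allP => x xP; apply/allP => y yP; move: (aP y yP).
  by rewrite row_hitE => /hasPn/(_ x xP); case: (y).
Qed.

Lemma count_fsetU1 (f : pred cell) P x : x \notin P ->
  count f (x |` P) = f x + count f P.
Proof.
move=> xP; rewrite -[RHS]/(count f (x :: P)); apply/permP/uniq_perm.
- exact: fset_uniq.
- by rewrite /= xP fset_uniq.
- by move=> y; rewrite !inE.
Qed.

Lemma mem_board n (h : nat -> nat) c :
  (c \in board n h) = (0 < c.1 <= n) && (0 < c.2 <= h c.1).
Proof.
case: c => i j; rewrite in_fset /=; apply/allpairsPdep/idP => /=.
  move=> [i' [j' [+ + [-> ->]]]]; rewrite !mem_iota; lia.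
by move=> ij; exists i, j; rewrite !mem_iota; split => //; lia.
Qed.

Lemma row_hit_rook P i t r : (forall x y, x \in P -> y \in P -> x.1 = y.1 -> x = y) ->
  (i, r) \in P ->
  row_hit J P i.+1 t =
  row_hit J P i t || among_first J (fun u => ~~ row_hit J P i u) r t.
Proof.
move=> uP irP /=; congr (_ || _); apply/hasP/idP.
  by move=> [x xP /andP[/eqP xi]]; rewrite (uP _ _ xP irP xi).
by move=> rt; exists (i, r) => //=; rewrite eqxx.
Qed.

Lemma row_hit_norook P i t : (forall r, (i, r) \notin P) ->
  row_hit J P i.+1 t = row_hit J P i t.
Proof.
move=> iP /=; rewrite [X in _ || X](_ : _ = false) ?orbF //.
apply/hasPn => -[i' r] xP; apply/negP => /andP[/eqP /= ii _].
by move: xP; rewrite ii (negbTE (iP r)).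
Qed.

Section Board.
Variables (n : nat) (h : nat -> nat).
Hypothesis hB : attacking_board J n h.
Variable P : {fset cell}.
Hypothesis PB : P `<=` board n h.
Hypothesis Pna : nonattacking J P.

Let uP : forall x y, x \in P -> y \in P -> x.1 = y.1 -> x = y.
Proof. by case/nonattackingP: Pna. Qed.

Lemma rook_free i r : (i, r) \in P -> ~~ row_hit J P i r.
Proof. by case/nonattackingP: Pna => _ aP /aP. Qed.

Lemma rook_range i r : (i, r) \in P -> (0 < i <= n) && (0 < r <= h i).
Proof. by move=> /(fsubsetP PB); rewrite mem_board. Qed.

Lemma row_hit_col1 t : row_hit J P 1 t = false.
Proof.
rewrite row_hit_norook // => r; apply/negP => /rook_range; lia.
Qed.

Lemma rook_or_none i : (exists r, (i, r) \in P) \/ (forall r, (i, r) \notin P).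
Proof.
have [/hasP[[i' r] xP /eqP /= <-]|/hasPn iP] := boolP (has (fun x => x.1 == i) P).
  by left; exists r.
by right => r; apply/negP => /iP /=; rewrite eqxx.
Qed.

Lemma board_step i r : 0 < i < n -> (i, r) \in P -> h i + J - 1 <= h i.+1.
Proof.
move=> i_range irP; have := rook_range irP => r_range.
by case: hB => _; apply => //; lia.
Qed.

(* The attacking condition leaves room in the next column for the [J] rows hit
   by each rook. *)
Lemma row_hit_range i t : 0 < i <= n -> row_hit J P i t -> 0 < t <= h i.
Proof.
elim: i t => // i IHi t i_range.
have [->|i0] := posnP i; first by rewrite row_hit_col1.
have hi : h i <= h i.+1 by case: hB => + _; apply; lia.
have {}IHi u : row_hit J P i u -> 0 < u <= h i by apply: IHi; lia.
have [[r irP]|iP] := rook_or_none i; last first.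
  by rewrite row_hit_norook // => /IHi; lia.
rewrite (row_hit_rook _ uP irP) => /orP[/IHi|]; first lia.
move=> /and3P[rt _ tJ]; have := rook_range irP => r_range.
have hiJ := board_step (i := i) (r := r) ltac:(lia) irP.
apply/andP; split; first lia.
rewrite leqNgt; apply/negP => ht.
(* At least [t - h i] free rows lie between [r] and [t], while fewer than [J] are allowed; so
   [t <= h i + J - 1], which is at most [h i.+1]. *)
have := @count_free_above (fun u => ~~ row_hit J P i u) r (h i) (t - r) ltac:(lia)
  (rook_free irP) _ ltac:(lia).
have fb u : h i < u -> ~~ row_hit J P i u by move=> hu; apply/negP => /IHi; lia.
move=> /(_ fb); lia.
Qed.

(** Seen from an unattacked row [j], an earlier rook above [j] hits exactly [J] rows, all above [j],
    and one weakly below [j] hits none above. The free bound [M] stays fixed while the induction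
    passes to shorter columns. *)
Lemma count_row_hit_above i j M : 0 < i <= n -> ~~ row_hit J P i j -> h i <= M ->
  count (row_hit J P i) (iota j.+1 (M - j)) = J * nw_rooks P (i, j).
Proof.
elim: i j M => // i IHi j M i_range.
have [->|i0] := posnP i.
  move=> _ _; rewrite (eq_count (a2 := pred0)) ?count_pred0; last exact: row_hit_col1.
  rewrite /nw_rooks (eq_in_count (a2 := pred0)) ?count_pred0 ?muln0 //.
  by move=> [i' r] /rook_range /=; lia.
have hi : h i <= h i.+1 by case: hB => + _; apply; lia.
have [[r irP]|iP] := rook_or_none i; last first.
  move=> fj hM; rewrite (eq_count (a2 := row_hit J P i)); last by move=> t; exact: row_hit_norook.
  rewrite IHi; [|lia|by rewrite -row_hit_norook|lia].
  congr (_ * _); apply: eq_in_count => -[i' r] xP /=.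
  have : i' <> i by move=> ii; move: xP; rewrite ii (negbTE (iP r)).
  lia.
have hitE t := row_hit_rook t uP irP.
rewrite hitE negb_or => /andP[fj aj] hM.
have := rook_range irP => r_range.
have hiJ := board_step (i := i) (r := r) ltac:(lia) irP.
have fb u : h i < u -> ~~ row_hit J P i u.
  by move=> hu; apply/negP => /(@row_hit_range i u ltac:(lia)); lia.
set A := among_first J (fun u => ~~ row_hit J P i u) r in hitE aj.
have -> : count (row_hit J P i.+1) (iota j.+1 (M - j)) =
    count (row_hit J P i) (iota j.+1 (M - j)) + count A (iota j.+1 (M - j)).
  rewrite (eq_count hitE) -[RHS]count_predUI [X in _ + X](_ : _ = 0) ?addn0 //.
  rewrite (eq_count (a2 := pred0)) ?count_pred0 // => t /=.
  by rewrite /A /among_first; case: (row_hit _ _ _ _); rewrite /= ?andbF.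
rewrite IHi //; [|lia|lia].
have -> : nw_rooks P (i.+1, j) = nw_rooks P (i, j) + (j < r).
  rewrite /nw_rooks /=; have -> : P = (i, r) |` (P `\ (i, r)) by rewrite fsetD1K.
  rewrite !count_fsetU1 ?in_fsetD1 ?eqxx //= ltnn ltnSn /= add0n addnC; congr (_ + _).
  apply: eq_in_count => -[i' r']; rewrite in_fsetD1 => /andP[ne xP] /=.
  have : i' <> i by move=> ii; move/eqP: ne; apply; apply: uP.
  lia.
rewrite mulnDr; congr (_ + _); case: ltnP => [jr|rj]; last first.
  rewrite muln0 (eq_in_count (a2 := pred0)) ?count_pred0 // => t.
  rewrite mem_iota => jt; apply/negbTE/negP => /(among_first_le rj fj aj); lia.
(* The interval is cut at the rook's row [r]: nothing below [r] is hit, and from [r] to [M] at least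
   [J] rows are free. *)
rewrite muln1 (_ : M - j = (r - j.+1) + (M.+1 - r)); last by lia.
rewrite iotaD count_cat [X in X + _](_ : _ = 0) ?add0n.
  rewrite (_ : j.+1 + (r - j.+1) = r) ?count_among_first; last by lia.
  apply/minn_idPl.
  have := @count_free_above (fun u => ~~ row_hit J P i u) r (h i) (M.+1 - r) ltac:(lia)
    (rook_free irP) fb ltac:(lia).
  lia.
rewrite (eq_in_count (a2 := pred0)) ?count_pred0 // => t.
by rewrite mem_iota => jt; apply/negbTE/negP => /and3P[+ _ _]; lia.
Qed.

(** Row 0 is off the board and never hit, and every rook lies to its upper left; the previous count
    at [j = 0] thus sees all rooks. *)
Lemma count_free_rows i : 0 < i <= n -> (forall x, x \in P -> x.1 < i) ->
  count (fun t => ~~ row_hit J P i t) (iota 1 (h i)) + J * #|` P| = h i.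
Proof.
move=> i_range Pi.
have f0 : ~~ row_hit J P i 0 by apply/negP => /(row_hit_range i_range).
have := count_row_hit_above i_range f0 (leqnn _); rewrite subn0.
have -> : nw_rooks P (i, 0) = #|` P|.
  rewrite /nw_rooks; apply/eqP; rewrite -all_count; apply/allP => -[i' r] xP /=.
  by have := Pi _ xP; have := rook_range xP => /=; lia.
by move=> <-; rewrite addnC count_predC size_iota.
Qed.

End Board.
End Hits.

(** * Adding a column to the board *)

Section Extension.
Local Open Scope nat_scope.
Variables (J n : nat) (h : nat -> nat).
Implicit Types (P : {fset cell}) (r j t : nat).

Definition placements_all (k : nat) : seq {fset cell} :=
  [seq P <- fpowerset (board k h) | nonattacking J P].

Lemma mem_placements_all k P :
  (P \in placements_all k) = (P `<=` board k h) && nonattacking J P.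
Proof. by rewrite mem_filter fpowersetE andbC. Qed.

Definition free_rows P : seq nat :=
  [seq r <- iota 1 (h n.+1) | ~~ row_hit J P n.+1 r].

Lemma board_col P x : P `<=` board n h -> x \in P -> 0 < x.1 <= n.
Proof. by move=> /fsubsetP PB /PB; rewrite mem_board => /andP[]. Qed.

Lemma last_col_notin P r : P `<=` board n h -> (n.+1, r) \notin P.
Proof. by move=> PB; apply/negP => /(board_col PB) /=; rewrite ltnn. Qed.

Lemma board_sub : board n h `<=` board n.+1 h.
Proof. by apply/fsubsetP => x; rewrite !mem_board; lia. Qed.

Lemma row_hit_fsetU1 P r i t : i <= n.+1 ->
  row_hit J ((n.+1, r) |` P) i t = row_hit J P i t.
Proof.
move=> i_le; apply: row_hit_eq => -[i' r'] /= ii.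
rewrite !inE; case: eqP => //= -[ii' _]; lia.
Qed.

Lemma nonattacking_fsetU1 P r : P `<=` board n h ->
  nonattacking J ((n.+1, r) |` P) = nonattacking J P && ~~ row_hit J P n.+1 r.
Proof.
move=> PB; have colP x : x \in P -> x.1 <= n.+1 by move=> /(board_col PB); lia.
apply/nonattackingP/andP => [[uP aP]|[/nonattackingP[uP aP] fr]]; split.
- apply/nonattackingP; split=> [x y xP yP|y yP].
    by apply: uP; rewrite !inE ?xP ?yP orbT.
  by rewrite -(row_hit_fsetU1 _ r) ?colP // aP // !inE yP orbT.
- by rewrite -(row_hit_fsetU1 _ r) //; apply: (aP (n.+1, r)); rewrite !inE eqxx.
- move=> x y; rewrite !inE => /predU1P[->|xP] /predU1P[->|yP] //=.
  + by move=> e; have := board_col PB yP; rewrite -e ltnn andbF.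
  + by move=> e; have := board_col PB xP; rewrite e ltnn andbF.
  + exact: uP.
- move=> y; rewrite !inE => /predU1P[->|yP]; first by rewrite row_hit_fsetU1.
  by rewrite row_hit_fsetU1 ?colP // aP.
Qed.

(** A rook in the last column attacks nothing, so it can be added exactly in the rows not hit;
    removing it inverts the operation. *)
Lemma placements_all_recr :
  perm_eq (placements_all n.+1)
    (placements_all n ++
     [seq (n.+1, r) |` P | P <- placements_all n, r <- free_rows P]).
Proof.
apply: uniq_perm; first by rewrite filter_uniq // fset_uniq.
  rewrite cat_uniq filter_uniq ?fset_uniq //=; apply/andP; split.
    apply/hasPn => _ /allpairsPdep[P [r [_ _ ->]]]; rewrite mem_placements_all.
    by apply/negP => /andP[/(last_col_notin r)]; rewrite !inE eqxx.
  apply: allpairs_uniq_dep => [||[P r] [Q s]].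
  - by rewrite filter_uniq // fset_uniq.
  - by move=> P _; rewrite filter_uniq // iota_uniq.
  move=> /allpairsPdep[P' [r' [PA _ [-> ->]]]] /allpairsPdep[Q' [s' [QA _ [-> ->]]]] /=.
  move: PA QA; rewrite !mem_placements_all => /andP[PB _] /andP[QB _] E.
  have rs : r' = s'.
    have : (n.+1, r') \in (n.+1, s') |` Q' by rewrite -E !inE eqxx.
    by rewrite !inE (negbTE (last_col_notin r' QB)) orbF => /eqP[].
  rewrite rs in E *; have PQ : P' = Q'; last by rewrite PQ.
  by rewrite -(fsetU1K (last_col_notin s' PB)) E fsetU1K // last_col_notin.
move=> P; rewrite mem_cat !mem_placements_all; apply/idP/orP.
  move=> /andP[PB Pna]; have [uP _] := nonattackingP _ _ Pna.
  have [[r rP]|noP] := rook_or_none P n.+1; last first.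
    left; rewrite Pna andbT; apply/fsubsetP => -[i j] ijP.
    have := fsubsetP PB _ ijP; rewrite !mem_board /=.
    have : i <> n.+1 by move=> E; move: ijP; rewrite E (negbTE (noP j)).
    lia.
  right; apply/allpairsPdep; exists (P `\ (n.+1, r)), r.
  have PrB : P `\ (n.+1, r) `<=` board n h.
    apply/fsubsetP => -[i j]; rewrite in_fsetD1 => /andP[ne ijP].
    have := fsubsetP PB _ ijP; rewrite !mem_board /=.
    have : i <> n.+1 by move=> E; move/eqP: ne; apply; apply: uP.
    lia.
  move: (Pna); rewrite -{1}(fsetD1K rP) nonattacking_fsetU1 // => /andP[Prna fr].
  rewrite mem_placements_all PrB Prna mem_filter fr fsetD1K //; split => //.
  by have := fsubsetP PB _ rP; rewrite mem_board mem_iota /=; lia.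
case=> [/andP[PB ->]|/allpairsPdep[Q [r [QA rQ ->]]]].
  by rewrite andbT (fsubset_trans PB board_sub).
move: QA rQ; rewrite mem_placements_all mem_filter mem_iota => /andP[QB Qna] /andP[fr r_range].
rewrite nonattacking_fsetU1 // Qna fr !andbT; apply/fsubsetP => x; rewrite in_fset1U.
case/predU1P => [->|/(fsubsetP QB)]; last exact: (fsubsetP board_sub).
by rewrite mem_board /=; lia.
Qed.

Lemma has_cancels P c : has (fun x => cancels J P x c) P =
  has (fun x : cell => (x.1 == c.1) && (c.2 < x.2)) P || row_hit J P c.1 c.2.
Proof. by rewrite row_hitE -has_predU; apply: eq_has => x; case: c. Qed.

Lemma mem_uncancelled (B P : {fset cell}) c : (c \in uncancelled J P B) =
  [&& c \in B, c \notin P,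
      ~~ has (fun x : cell => (x.1 == c.1) && (c.2 < x.2)) P & ~~ row_hit J P c.1 c.2].
Proof. by rewrite in_fset inE /= has_cancels negb_or. Qed.

Lemma uncancelled_uniq (B P : {fset cell}) : uniq (uncancelled J P B).
Proof. exact: fset_uniq. Qed.

Definition last_col (s : seq nat) : seq cell := [seq (n.+1, j) | j <- s].

Lemma mem_last_col s i j : ((i, j) \in last_col s) = (i == n.+1) && (j \in s).
Proof.
apply/mapP/andP => [[k ks [-> ->]]|[/eqP -> js]]; first by rewrite eqxx.
by exists j.
Qed.

(** Common core of the next two lemmas: [a] is the extra condition in the last column, trivial
    without a rook there and [r < j] with a rook in row [r]. *)
Lemma perm_uncancelled (Q P : {fset cell}) (a : pred nat) : P `<=` board n h ->
  (forall c, c.1 <= n ->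
    (c \in uncancelled J Q (board n.+1 h)) = (c \in uncancelled J P (board n h))) ->
  (forall j, 0 < j <= h n.+1 ->
    ((n.+1, j) \in uncancelled J Q (board n.+1 h)) =
    ~~ row_hit J P n.+1 j && a j) ->
  perm_eq (uncancelled J Q (board n.+1 h))
    (uncancelled J P (board n h) ++
     last_col [seq j <- iota 1 (h n.+1) | ~~ row_hit J P n.+1 j && a j]).
Proof.
move=> PB low high; apply: uniq_perm; first exact: uncancelled_uniq.
  rewrite cat_uniq uncancelled_uniq map_inj_uniq ?filter_uniq ?iota_uniq ?andbT //=.
    apply/hasPn => -[i j]; rewrite mem_last_col mem_uncancelled => /andP[/eqP -> _].
    by rewrite mem_board ltnn andbF.
  by move=> j k [].
move=> [i j]; rewrite mem_cat mem_last_col mem_filter mem_iota.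
have [i_le|i_gt] := leqP i n.
  by rewrite low //= [i == _](_ : _ = false) ?orbF //; lia.
rewrite [X in _ = X || _](_ : _ = false); last first.
  by rewrite mem_uncancelled mem_board /=; lia.
have [->|i_ne] := eqVneq i n.+1; last first.
  by rewrite mem_uncancelled mem_board /=; lia.
have [j_range|j_out] := boolP (0 < j <= h n.+1).
  by rewrite high //= andbT.
by rewrite mem_uncancelled mem_board /= leqnn (negbTE j_out) !andbF.
Qed.

Lemma perm_uncancelled_norook P : P `<=` board n h ->
  perm_eq (uncancelled J P (board n.+1 h))
    (uncancelled J P (board n h) ++ last_col (free_rows P)).
Proof.
move=> PB; rewrite /free_rows -(eq_filter (a1 := fun j => ~~ row_hit J P n.+1 j && true)).
  apply: perm_uncancelled => // [[i j] /= i_le|j j_range]; rewrite !mem_uncancelled /=.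
    by rewrite !mem_board /= i_le (leqW i_le).
  rewrite mem_board /= leqnn j_range last_col_notin // andbT /=.
  have -> : has (fun x : cell => (x.1 == n.+1) && (j < x.2)) P = false.
    by apply/negbTE/hasPn => x /(board_col PB) x1;
       apply/negP => /andP[/eqP e _]; move: x1; rewrite e ltnn andbF.
  by rewrite andbT.
by move=> j; rewrite andbT.
Qed.

Lemma perm_uncancelled_rook P r : P `<=` board n h -> ~~ row_hit J P n.+1 r ->
  0 < r <= h n.+1 ->
  perm_eq (uncancelled J ((n.+1, r) |` P) (board n.+1 h))
    (uncancelled J P (board n h) ++
     last_col [seq j <- iota 1 (h n.+1) | ~~ row_hit J P n.+1 j && (r < j)]).
Proof.
move=> PB fr r_range; apply: perm_uncancelled => // [[i j] /= i_le|j j_range];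
  rewrite !mem_uncancelled row_hit_fsetU1 ?(leqW i_le) // ?leqW //.
  rewrite !mem_board /= i_le (leqW i_le) !inE.
  rewrite xpair_eqE (_ : (i == n.+1) = false) /=; last lia.
  congr [&& _, _, ~~ _ & _]; apply/hasP/hasP => -[x]; last first.
    by move=> xP ?; exists x => //; rewrite !inE xP orbT.
  rewrite !inE => /predU1P[->|xP] /=; first by lia.
  by exists x.
set hit := row_hit J P (n.+1, j).1 (n.+1, j).2.
have -> : has (fun x : cell => (x.1 == (n.+1, j).1) && ((n.+1, j).2 < x.2)) ((n.+1, r) |` P) = (j < r).
  apply/hasP/idP => [[x]|jr]; last by exists (n.+1, r); rewrite ?inE eqxx.
  rewrite !inE => /predU1P[-> /=|xP]; first by rewrite eqxx.
  by move=> /andP[/eqP e _]; have := board_col PB xP; rewrite e ltnn andbF.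
rewrite mem_board !inE xpair_eqE eqxx (negbTE (last_col_notin j PB)) orbF.
rewrite /= leqnn j_range; case: (hit) => /=; first by rewrite !andbF.
by rewrite andbT; lia.
Qed.

Lemma nw_rooks_fsetU1 P r c : P `<=` board n h -> c.1 <= n.+1 ->
  nw_rooks ((n.+1, r) |` P) c = nw_rooks P c.
Proof.
move=> PB cn; rewrite /nw_rooks count_fsetU1 ?last_col_notin //=.
by rewrite ltnNge cn.
Qed.

End Extension.

(** The induction adds a row [m] at the bottom, the top end [T] being fixed. If [m] is free with [c]
    free rows above, then [E c = 1 + w c * E c.+1] is used: the [1] puts a rook on [m], and [w c]
    leaves it empty. *)
Lemma column_sum (A : comPzRingType) (E w : nat -> A) (free : pred nat) (T k m : nat) :
  (forall i, E i = 1 + w i * E i.+1) -> (m + k)%N = T ->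
  E 0%N =
  \sum_(r <- iota m k | free r)
    \prod_(j <- iota m k | free j && (r < j)%N) w (count free (iota j.+1 (T - j.+1))) +
  (\prod_(j <- iota m k | free j) w (count free (iota j.+1 (T - j.+1)))) *
    E (count free (iota m k)).
Proof.
move=> hE; elim: k m => [|k IHk] m mT; first by rewrite !big_nil add0r mul1r.
rewrite (IHk m.+1); last by rewrite -mT addSnnS.
rewrite /= !big_cons ltnn andbF (_ : T - m.+1 = k)%N; last by lia.
have -> : \sum_(r <- iota m.+1 k | free r) \prod_(j <- m :: iota m.+1 k | free j && (r < j)%N)
      w (count free (iota j.+1 (T - j.+1))) =
    \sum_(r <- iota m.+1 k | free r) \prod_(j <- iota m.+1 k | free j && (r < j)%N)
      w (count free (iota j.+1 (T - j.+1))).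
  rewrite [LHS]big_seq_cond [RHS]big_seq_cond; apply: eq_bigr => r /andP[+ _].
  by rewrite mem_iota big_cons => r_range; rewrite (_ : (r < m)%N = false) ?andbF //; lia.
have -> : \prod_(j <- iota m.+1 k | free j && (m < j)%N) w (count free (iota j.+1 (T - j.+1))) =
    \prod_(j <- iota m.+1 k | free j) w (count free (iota j.+1 (T - j.+1))).
  rewrite [LHS]big_seq_cond [RHS]big_seq_cond; apply: eq_bigl => j.
  by rewrite mem_iota; case: (free j) => //=; lia.
case: (free m) => /=; last by rewrite add0n.
by rewrite add1n [in LHS]hE; ring.
Qed.

(** * The product formula for any sequence [E] satisfying the recursion *)

Section Factorization.
Context {C : numFieldType} (a b q p : C) (J : nat) (h : nat -> nat) (E : int -> C).
Hypothesis E_rec : forall s, E s = 1 + weight a b q p (s + 1) * E (s + 1).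

Definition falling_E (k : nat) : C :=
  \prod_(1 <= j < k.+1) E (J%:Z * (j%:Z - 1)).

Definition board_weight (n : nat) (P : {fset cell}) : C :=
  placement_weight a b q p J (board n h) P.

Definition free_above (n : nat) (P : {fset cell}) (j : nat) : nat :=
  count (fun t => ~~ row_hit J P n.+1 t) (iota j.+1 ((h n.+1).+1 - j.+1)).

Definition col_start (n : nat) : int := J%:Z * n%:Z - (h n.+1)%:Z.

Section Column.
Variable n : nat.
Hypothesis hB : attacking_board J n.+1 h.
Variable P : {fset cell}.
Hypothesis PB : P `<=` board n h.
Hypothesis Pna : nonattacking J P.

Let PB1 : P `<=` board n.+1 h.
Proof. exact: fsubset_trans PB (board_sub _ _). Qed.

(** Of the [h n.+1 - j] rows above [j], exactly [J] per rook to the upper left are hit; the others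
    are free. Hence the weights of the free cells, from the top down, have consecutive exponents. *)
Lemma cell_exponent (j : nat) : (0 < j <= h n.+1)%N -> ~~ row_hit J P n.+1 j ->
  J%:Z * ((n.+1, j).1%:Z - 1) + 1 - (n.+1, j).2%:Z - J%:Z * (nw_rooks P (n.+1, j))%:Z =
  col_start n + 1 + (free_above n P j)%:Z.
Proof.
move=> j_range fj; rewrite /free_above subSS /=.
have c1 := count_predC (row_hit J P n.+1) (iota j.+1 (h n.+1 - j)).
rewrite (@count_row_hit_above J n.+1 h hB P PB1 Pna n.+1 j (h n.+1) (leqnn _) fj (leqnn _)) in c1.
move: c1; rewrite size_iota -[count (predC _) _]/(count (fun t => ~~ row_hit J P n.+1 t) _).
by rewrite /col_start; lia.
Qed.

Lemma board_weight_norook :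
  board_weight n.+1 P = board_weight n P *
  \prod_(j <- iota 1 (h n.+1) | ~~ row_hit J P n.+1 j)
    weight a b q p (col_start n + 1 + (free_above n P j)%:Z).
Proof.
rewrite /board_weight /placement_weight (perm_big _ (perm_uncancelled_norook J PB)) big_cat /=.
congr (_ * _); rewrite big_map big_filter big_seq_cond [RHS]big_seq_cond.
apply: eq_bigr => j /andP[]; rewrite mem_iota add1n ltnS => j_range fj.
by rewrite cell_exponent.
Qed.

Lemma board_weight_rook (r : nat) : r \in free_rows J n h P ->
  board_weight n.+1 ((n.+1, r) |` P) = board_weight n P *
  \prod_(j <- iota 1 (h n.+1) | ~~ row_hit J P n.+1 j && (r < j)%N)
    weight a b q p (col_start n + 1 + (free_above n P j)%:Z).
Proof.
rewrite mem_filter mem_iota add1n ltnS => /andP[fr r_range].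
rewrite /board_weight /placement_weight (perm_big _ (perm_uncancelled_rook PB fr r_range)) big_cat /=.
congr (_ * _).
  rewrite big_seq [RHS]big_seq; apply: eq_bigr => c.
  rewrite mem_uncancelled mem_board => /andP[/andP[c_range _] _].
  by rewrite (nw_rooks_fsetU1 _ PB) //; lia.
rewrite big_map big_filter big_seq_cond [RHS]big_seq_cond.
apply: eq_bigr => j /andP[]; rewrite mem_iota add1n ltnS => j_range /andP[fj _].
by rewrite (nw_rooks_fsetU1 _ PB) // cell_exponent.
Qed.

(** This is [column_sum] started at [col_start n]. By [count_free_rows], one step per free row leads
    to the argument [J * (n - k)], where [k] is the number of rooks in [P]. *)
Lemma column_identity :
  \sum_(r <- free_rows J n h P) board_weight n.+1 ((n.+1, r) |` P) +
    board_weight n.+1 P * E (J%:Z * (n%:Z - #|` P|%:Z)) =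
  board_weight n P * E (col_start n).
Proof.
have E_shift i : E (col_start n + i%:Z) =
    1 + weight a b q p (col_start n + 1 + i%:Z) * E (col_start n + i.+1%:Z).
  by rewrite E_rec addrAC (_ : col_start n + i.+1%:Z = col_start n + 1 + i%:Z) //; lia.
have := column_sum (fun t => ~~ row_hit J P n.+1 t) E_shift (add1n (h n.+1)).
rewrite addr0 => ->; rewrite [in RHS]mulrDr mulr_sumr board_weight_norook; congr (_ + _).
  rewrite /free_rows big_filter big_seq_cond [RHS]big_seq_cond.
  apply: eq_bigr => r /andP[r_range fr].
  by rewrite board_weight_rook // mem_filter fr.
rewrite -mulrA; congr (_ * (_ * E _)).
have Pn x : x \in P -> (x.1 < n.+1)%N by move=> /(board_col PB); lia.
have := @count_free_rows J n.+1 h hB P PB1 Pna n.+1 (leqnn _) Pn.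
by rewrite /col_start; lia.
Qed.

End Column.

Lemma attacking_board_pred (n : nat) : attacking_board J n.+1 h -> attacking_board J n h.
Proof.
by move=> [h1 h2]; split=> i i_range; [apply: h1|apply: h2]; lia.
Qed.

Lemma placements_all0 : placements_all J h 0 = [:: fset0].
Proof.
have B0 : board 0 h = fset0.
  by apply/fsetP => c; rewrite mem_board in_fset0; lia.
apply: perm_small_eq => //; apply: uniq_perm => // [|P].
  by rewrite filter_uniq // fset_uniq.
rewrite mem_placements_all B0 fsubset0 inE.
by case: eqP => //= ->; apply/nonattackingP; split.
Qed.

Lemma card_placement (n : nat) (P : {fset cell}) :
  P \in placements_all J h n -> (#|` P| <= n)%N.
Proof.
elim: n P => [|n IHn] P; first by rewrite placements_all0 inE => /eqP ->; rewrite cardfs0.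
rewrite (perm_mem (placements_all_recr J n h)) mem_cat => /orP[/IHn/leqW //|].
move=> /allpairsPdep[Q [r [QA _ ->]]]; rewrite cardfsU1.
by have := IHn _ QA; case: (_ \notin _) => /=; lia.
Qed.

(** The factor of the new column is absorbed placement by placement. A new rook leaves the number of
    rookless columns unchanged; without one, [falling_E] gains the factor produced by
    [column_identity]. *)
Lemma placement_sum (n : nat) : attacking_board J n h ->
  \prod_(1 <= i < n.+1) E (J%:Z * (i%:Z - 1) - (h i)%:Z) =
  \sum_(P <- placements_all J h n) board_weight n P * falling_E (n - #|` P|).
Proof.
elim: n => [|n IHn] hB.
  rewrite placements_all0 big_seq1 big_geq // /falling_E cardfs0 big_geq // mulr1.
  rewrite /board_weight /placement_weight big1_fset // => c.
  by rewrite mem_uncancelled mem_board; lia.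
rewrite big_nat_recr //= (IHn (attacking_board_pred hB)).
rewrite (perm_big _ (placements_all_recr J n h)) big_cat big_allpairs_dep /=.
rewrite -big_split mulr_suml /= big_seq [RHS]big_seq; apply: eq_bigr => P PA.
have := PA; rewrite mem_placements_all => /andP[PB Pna].
have Pn := card_placement PA.
have -> : J%:Z * (n.+1%:Z - 1) - (h n.+1)%:Z = col_start n by rewrite /col_start; lia.
rewrite mulrAC -(column_identity hB PB Pna) mulrDl [RHS]addrC; congr (_ + _).
  rewrite mulr_suml big_seq [RHS]big_seq; apply: eq_bigr => r rP.
  by rewrite cardfsU1 (last_col_notin r PB).
rewrite subSn // [falling_E _.+1]/falling_E big_nat_recr //= -/(falling_E _).
rewrite -mulrA [X in _ * X]mulrC; congr (_ * (_ * E (_ * _))).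
by rewrite -[(n - _).+1]addn1 PoszD addrK subzn.
Qed.

Lemma rook_numberE (n k : nat) :
  rook_number a b q p J k (board n h) =
  \sum_(P <- placements_all J h n | #|` P| == k) board_weight n P.
Proof.
rewrite /rook_number -[RHS]big_filter; apply: perm_big; apply: uniq_perm.
- exact: fset_uniq.
- by rewrite !filter_uniq // fset_uniq.
- move=> P; rewrite in_fset inE /= mem_filter mem_placements_all fpowersetE.
  by rewrite andbC -andbA andbC andbA.
Qed.

Lemma rook_factorization (n : nat) : attacking_board J n h ->
  \prod_(1 <= i < n.+1) E (J%:Z * (i%:Z - 1) - (h i)%:Z) =
  \sum_(0 <= k < n.+1) rook_number a b q p J (n - k) (board n h) * falling_E k.
Proof.
move=> hB; rewrite placement_sum //.
under [RHS]eq_bigr do rewrite rook_numberE big_mkcond mulr_suml.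
rewrite exchange_big /= big_seq [RHS]big_seq; apply: eq_bigr => P /card_placement Pn.
(* After the sums are exchanged, each placement contributes to a single [k], its number of rookless
   columns. *)
rewrite (eq_big_nat _ _ (F2 := fun k => if k == (n - #|` P|)%N then
  board_weight n P * falling_E k else 0)).
  by rewrite -big_mkcond big_nat1_eq ltnS leq_subr.
move=> k k_range; rewrite (_ : (#|` P| == n - k)%N = (k == n - #|` P|)%N); last by lia.
by case: ifP => // _; rewrite mul0r.
Qed.

End Factorization.

Theorem theorem4p3 (R : realType) (a b q p lam z : complex R)
    (J n : nat) (h : nat -> nat)
    (a_neq0 : a != 0) (b_neq0 : b != 0) (q_neq0 : q != 0) (p_lt1 : `|p| < 1)
    (q_lam : q = cexp lam)
    (weight_def : forall k : int, weight_den a b q p k != 0)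
    (ellnum_def : forall s : int,
       ellnum_den lam (a * q ^ (2 * s)) (b * q ^ s) p (z - s%:~R) != 0)
    (J_ge1 : (1 <= J)%N)
    (hB : attacking_board J n h) :
  \prod_(1 <= i < n.+1)
    ellnum lam
      (a * q ^ (2 * (J%:Z * (i%:Z - 1) - (h i)%:Z)))
      (b * q ^ (J%:Z * (i%:Z - 1) - (h i)%:Z)) p
      (z + (h i)%:R - (J * (i - 1))%:R)
  = \sum_(0 <= k < n.+1)
      rook_number a b q p J (n - k) (board n h) *
      \prod_(1 <= j < k.+1)
        ellnum lam
          (a * q ^ (2 * (J%:Z * (j%:Z - 1))))
          (b * q ^ (J%:Z * (j%:Z - 1))) p
          (z - (J * (j - 1))%:R).
Proof.
pose E (s : int) := ellnum lam (a * q ^ (2 * s)) (b * q ^ s) p (z - s%:~R).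
have E_rec s : E s = 1 + weight a b q p (s + 1) * E (s + 1) by exact: ellnum_rec.
(* The arguments use natural subtraction and the parameters use integers; the two agree because the
   product indices start at 1. *)
have natE (m i : nat) : (m * (i - 1))%:R = (m%:Z * (i - 1)%N%:Z)%:~R :> complex R.
  by rewrite -PoszM.
have -> : \prod_(1 <= i < n.+1)
    ellnum lam
      (a * q ^ (2 * (J%:Z * (i%:Z - 1) - (h i)%:Z)))
      (b * q ^ (J%:Z * (i%:Z - 1) - (h i)%:Z)) p
      (z + (h i)%:R - (J * (i - 1))%:R) =
    \prod_(1 <= i < n.+1) E (J%:Z * (i%:Z - 1) - (h i)%:Z).
  apply: eq_big_nat => i i_range; rewrite /E natE -subzn; last by lia.
  by rewrite intrB opprB addrA.
rewrite (rook_factorization E_rec hB).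
apply: eq_big_nat => k _; congr (_ * _); apply: eq_big_nat => j j_range.
by rewrite /E natE -subzn; last by lia.
Qed.
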